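(* There exists a constant $C>0$ such that for every $n>0$ and every algebraic subset $\Delta\subset\mathrm{End}(V^{\otimes(n+1)})$ with $\dim\Delta = p$ and $\deg\Delta = D$, there exists a Boolean function $f:\{0,1\}^n\to\{0,1\}$ whose stringent quantum complexity relative to $\Delta$ is at least \[ C\cdot\frac{2^n}{p\cdot n+\log D}. \]
   Context: $V$ is a 2-dimensional complex Hermitian space with orthonormal basis $|0\rangle,|1\rangle$; $V^{\otimes m}$ has orthonormal basis $|\mathbf{x}\rangle = |x_{m-1}\rangle\otimes\cdots\otimes|x_0\rangle$ for bit strings. $\mathrm{End}(V^{\otimes(n+1)})$ is regarded as a complex affine space and $\Delta$ as a complex algebraic subset of it. For a Boolean function $f$, $U_f$ is the unitary on $V^{\otimes(n+1)}$ with $U_f(|\mathbf{x}\rangle\otimes|y\rangle) = |\mathbf{x}\rangle\otimes|f(x)\oplus y\rangle$ for $x\in\{0,1\}^n$, $y\in\{0,1\}$. For $\Delta\subset\mathrm{End}(V^{\otimes(n+1)})$, the stringent quantum complexity of $f$ relative to $\Delta$ is $\mathrm{rank}_{\mathrm{End}(V^{\otimes(n+1)}),\Delta}(U_f)$, the smallest $t$ such that $U_f = \alpha_1\cdots\alpha_t$ with all $\alpha_i\in\Delta$ ($\infty$ if none). *)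

(* Defs.v *)
From HB Require Import structures.
From mathcomp Require Import all_boot all_order all_algebra.
From mathcomp Require Import all_classical all_reals all_analysis.
From mathcomp Require Import complex.
From mathcomp Require mpoly.

Set Implicit Arguments.
Unset Strict Implicit.
Unset Printing Implicit Defensive.

Import Order.TTheory GRing.Theory Num.Theory.
Local Open Scope ring_scope.
Local Open Scope classical_set_scope.

(* Ambient space.  K := R[i] (the complex numbers built over a real   *)
(* type R).  End(V^{(n+1)}) is identified with the square matrices of *)
(* size 2^(n+1) (matrix entries w.r.t. the computational basis),      *)
(* composition of operators being matrix product.                     *)

Definition qdim (n : nat) : nat := 2 ^ n.+1.

Notation End_ R n := 'M[R[i]]_(qdim n).

Definition coords (R : rcfType) (n : nat) (A : End_ R n) :
  'I_(qdim n * qdim n) -> R[i] := fun k => mxvec A 0 k.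

Notation poly_End R n := (mpoly.mpoly (qdim n * qdim n) R[i]).

Definition zero_locus (R : rcfType) (n : nat) (P : set (poly_End R n)) :
  set (End_ R n) :=
  [set A | forall q, P q -> mpoly.meval (coords A) q = 0].

Definition algebraic (R : rcfType) (n : nat) (S : set (End_ R n)) : Prop :=
  exists P : set (poly_End R n), S = zero_locus P.

Definition irreducible (R : rcfType) (n : nat) (Z : set (End_ R n)) : Prop :=
  [/\ algebraic Z, Z !=set0 &
      forall Z1 Z2 : set (End_ R n), algebraic Z1 -> algebraic Z2 ->
        Z = Z1 `|` Z2 -> Z = Z1 \/ Z = Z2].

Definition irr_chain (R : rcfType) (n : nat) (S : set (End_ R n)) (k : nat) :=
  exists Z : nat -> set (End_ R n),
    [/\ forall i, (i <= k)%N -> irreducible (Z i),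
        forall i, (i <= k)%N -> Z i `<=` S &
        forall i, (i < k)%N -> Z i `<` Z i.+1].

Definition has_dim (R : rcfType) (n : nat) (S : set (End_ R n)) (d : nat) :=
  irr_chain S d /\ ~ irr_chain S d.+1.

Definition affine_subspace (R : rcfType) (n : nat) (k : nat)
  (E : set (End_ R n)) : Prop :=
  exists (a : End_ R n) (B : 'I_k -> End_ R n),
    \rank (\matrix_(i < k) mxvec (B i)) = k /\
    E = [set a + \sum_(i < k) u i *: B i | u in [set: 'I_k -> R[i]]].

Definition finite_card (T : eqType) (X : set T) (c : nat) : Prop :=
  exists s : seq T, uniq s /\ size s = c /\ X = [set x | x \in s].

(* degree of an irreducible algebraic set Z of dimension d (Heintz):   *)
(* the maximal number of points of Z cap E, E an affine subspace of    *)
(* complementary dimension N - d with Z cap E finite.                  *)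
Definition irr_degree (R : rcfType) (n : nat) (Z : set (End_ R n)) (c : nat) :=
  exists d : nat,
  [/\ irreducible Z, has_dim Z d,
      (exists E, affine_subspace (qdim n * qdim n - d) E /\
                 finite_card (Z `&` E) c) &
      forall E c', affine_subspace (qdim n * qdim n - d) E ->
                   finite_card (Z `&` E) c' -> (c' <= c)%N].

Definition irr_component (R : rcfType) (n : nat) (S Z : set (End_ R n)) :=
  [/\ irreducible Z, Z `<=` S &
      forall Z', irreducible Z' -> Z `<=` Z' -> Z' `<=` S -> Z' = Z].

Definition has_degree (R : rcfType) (n : nat) (S : set (End_ R n)) (D : nat) :=
  exists (k : nat) (Zs : 'I_k -> set (End_ R n)) (cs : 'I_k -> nat),
  [/\ injective Zs,
      forall i, irr_component S (Zs i),
      forall Z, irr_component S Z -> exists i, Z = Zs i,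
      forall i, irr_degree (Zs i) (cs i) &
      D = (\sum_(i < k) cs i)%N].

(* Basis |x_m-1 ... x_0> of V^{m} is indexed by sum_i x_i 2^i, so the  *)
(* index of |x> (x) |y> (x in {0,1}^n, y in {0,1}) is 2 * x + y.       *)

Definition bits (n k : nat) : {ffun 'I_n -> bool} :=
  [ffun i : 'I_n => odd (k %/ 2 ^ i)].

Definition U_ (R : rcfType) (n : nat) (f : {ffun 'I_n -> bool} -> bool) :
  End_ R n :=
  \matrix_(r, c)
    ((r %/ 2 == c %/ 2)%N && (odd r == f (bits n (c %/ 2)) (+) odd c))%:R.

(* stringent quantum complexity: smallest t >= 1 with U = a_1 ... a_t, *)
(* a_i in Delta; +oo if there is none.                                  *)
Definition factors_in (R : rcfType) (n : nat) (Delta : set (End_ R n))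
  (U : End_ R n) (t : nat) : Prop :=
  (0 < t)%N /\
  exists al : 'I_t -> End_ R n,
    (forall i, Delta (al i)) /\ U = \prod_(i < t) al i.

Definition stringent_complexity (R : realType) (n : nat)
  (Delta : set (End_ R n)) (U : End_ R n) : \bar R :=
  ereal_inf [set (t%:R)%:E | t in [set t | factors_in Delta U t]].

(* Main.v *)
(* The polynomials of degree at most [2^n] separate the operators [U_f]: the one
   attached to [g] is the product, over all [x], of the entry of an operator which
   [U_f] sets to [1] exactly when [f x = g x].  If on [Delta] the polynomials of
   degree at most [2^n] are spanned by [h] functions, then on products of [t]
   elements of [Delta] they are spanned by [h^t] functions, so that at most [h^t]
   functions [f] have complexity [t].

   The bound [h <= D (2^n + 1)^p] reduces to an irreducible set with generic point
   [x].  After Noether normalization by linear forms [y], the field [K(x)] has some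
   degree [e] over [K(y)].  A polynomial of degree at most [m] whose [e] coordinates
   over [K(y)] vanish to order [m + 1] at a good point is zero, because its large
   powers have coordinates of too small a degree; hence [h <= e (m + 1)^p].  The
   fibre of [y] over a good point is a linear section with exactly [e] points, so
   [e] is at most the degree.

   When [p = 0] and [D = 1], [Delta] is a single point [A], and the powers of [A]
   contain at most one involution besides [1], while all [U_f] are involutions. *)

From HB Require Import structures.
From mathcomp Require Import all_boot all_order all_algebra fieldext separable.
From mathcomp Require mpoly.
From mathcomp Require Import zify ring lra.
From mathcomp Require boolp.
From Stdlib Require Import Classical_Prop.

Set Implicit Arguments.
Unset Strict Implicit.
Unset Printing Implicit Defensive.

Import Order.TTheory GRing.Theory Num.Theory.
Local Open Scope ring_scope.

(** * Polynomials in several variables: extensionality and points of nonvanishing *)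

Module MpolyFacts.
Import mpoly.

(** The bound on the Hilbert function has to hold for every [m], with the degree itself as its
    constant. It is used at [m = 2 ^ n], where its logarithm has the order of [p n + log D]. An
    asymptotic estimate would not do, since [m] and the ambient dimension both grow with [n]. The
    definitions of degree and dimension shape the rest. The degree counts points of finite linear
    sections, so the transcendence basis [y] must consist of linear forms over [K], whose fibres are
    linear sections. The dimension is the length of chains of irreducible sets, so it must be
    identified with the transcendence degree. The bound on the Hilbert function serves there as
    well, because it limits the number of independent monomials. On the circuit side, multiplication
    of operators is bilinear: a polynomial of degree [m] in a product has degree at most [m] in each
    factor. The degree therefore stays at [2 ^ n] however long the product is, and only the number
    of functions is multiplied. *)

Lemma mpoly_rmorph_ext (n : nat) (K : comNzRingType) (L : nzRingType)
    (f g : {rmorphism {mpoly K[n]} -> L}) :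
  (forall c, f c%:MP = g c%:MP) -> (forall i, f 'X_i = g 'X_i) -> f =1 g.
Proof.
move=> hC hX p; rewrite (mpolyE p) !rmorph_sum; apply: eq_bigr => m _.
rewrite -mul_mpolyC !rmorphM hC; congr (_ * _).
rewrite mpolyXE_id !rmorph_prod; apply: eq_bigr => i _.
by rewrite !rmorphXn hX.
Qed.

Lemma digits_inj (D n : nat) (a b : 'I_n -> nat) :
  (forall i, a i < D)%N -> (forall i, b i < D)%N ->
  (\sum_i a i * D ^ i = \sum_i b i * D ^ i)%N -> a =1 b.
Proof.
elim: n a b => [|n IH] a b ha hb; first by move=> _ [].
rewrite !big_ord_recl /= !expn0 !muln1 => e.
have D0 : (0 < D)%N by apply: leq_ltn_trans (ha ord0).
have shift (c : 'I_n.+1 -> nat) :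
  (\sum_(i < n) c (lift ord0 i) * D ^ bump 0 i =
   (\sum_(i < n) c (lift ord0 i) * D ^ i) * D)%N.
  rewrite big_distrl /=; apply: eq_bigr => i _.
  by rewrite /bump /= add1n expnS -mulnA (mulnC D).
rewrite !shift in e.
have e0 : a ord0 = b ord0.
  have := congr1 (fun k => k %% D)%N e.
  by rewrite ![(_ ord0 + _)%N]addnC !modnMDl !modn_small.
move: e; rewrite e0 => /addnI/eqP; rewrite eqn_pmul2r// => /eqP e.
have e1 := IH (fun i => a (lift ord0 i)) (fun i => b (lift ord0 i)) 
   (fun i => ha _) (fun i => hb _) e.
by move=> i; case: (unliftP ord0 i) => [j ->|->//]; apply: e1.
Qed.

(* Kronecker substitution [x_i := t ^ (d ^ i)] reduces to one variable. *)
Lemma mpoly_nonvanishing (K : numFieldType) (n : nat) (f : {mpoly K[n]}) :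
  f != 0 -> exists v : 'I_n -> K, f.@[v] != 0.
Proof.
move=> f0; set d := msize f.
pose w (m : 'X_{1..n}) := (\sum_(i < n) m i * d ^ i)%N.
pose p : {poly K} := \sum_(m <- msupp f) f@_m *: 'X^(w m).
have pe t : p.[t] = f.@[fun i => t ^+ (d ^ i)].
  rewrite mevalE horner_sum; apply: eq_bigr => m _.
  rewrite hornerZ hornerXn; congr (_ * _).
  rewrite /w -prodrXr; apply: eq_bigr => i _.
  by rewrite -exprM mulnC.
have p0 : p != 0.
  have /= hm := mlead_supp f0; set m0 := mlead f in hm.
  apply/eqP => /(congr1 (fun q : {poly K} => q`_(w m0))).
  rewrite coef_sum coef0 (bigD1_seq m0) ?msupp_uniq //= big1_seq.
    rewrite addr0 coefZ coefXn eqxx mulr1 => /eqP.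
    by rewrite mcoeff_eq0 hm.
  move=> m /andP[mm0 hm']; rewrite coefZ coefXn.
  case: eqP => [e|]; last by rewrite mulr0.
  case/eqP: mm0; apply/mnmP.
  have small (m' : 'X_{1..n}) i : m' \in msupp f -> (m' i < d)%N.
    move=> /msize_mdeg_lt; apply: leq_ltn_trans.
    by rewrite mdegE (bigD1 i) //= leq_addr.
  by apply: (digits_inj (D := d)) (esym e) => i; apply: small.
(* In characteristic zero the first [size p] natural numbers are distinct, too many to be all roots
   of [p]. *)
have [t ht] : exists t, p.[t] != 0.
  apply: NNPP => H; pose rs : seq K := [seq i%:R | i <- iota 0 (size p)].
  have H1 : all (root p) rs.
    by apply/allP => t _; apply: contra_notT H => ?; exists t.
  have H2 : uniq rs.
    by rewrite map_inj_uniq ?iota_uniq // => i j /eqP; rewrite eqr_nat => /eqP.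
  by have := max_poly_roots p0 H1 H2; rewrite size_map size_iota ltnn.
by exists (fun i => t ^+ (d ^ i)); rewrite -pe.
Qed.

End MpolyFacts.

(** * Noether normalization *)

Module WeightedDegree.
Import mpoly.

Definition alg_indep (K L : comNzRingType) (emb : {rmorphism K -> L}) (s : nat)
    (y : 'I_s -> L) :=
  forall f : {mpoly K[s]}, mmap emb y f = 0 -> f = 0.

Definition lincomb (K L : comNzRingType) (emb : {rmorphism K -> L}) (s N : nat)
    (M : 'M[K]_(s, N)) (x : 'I_N -> L) : 'I_s -> L :=
  fun i => \sum_j emb (M i j) * x j.

(* [x] is filtered finite over [y]: the degree of the coefficients does not
   exceed that of [G]. *)
Definition filtered_finite (K L : comNzRingType) (emb : {rmorphism K -> L})
    (N s : nat) (x : 'I_N -> L) (y : 'I_s -> L) :=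
  exists (I : finType) (b : I -> {mpoly K[N]}), forall G : {mpoly K[N]},
    exists C : I -> {mpoly K[s]}, (forall i, msize (C i) <= msize G)%N /\
      mmap emb x G = \sum_i mmap emb y (C i) * mmap emb x (b i).

Section Weighted.
Variables (K : fieldType) (s : nat).
Implicit Types (p q : {poly {mpoly K[s]}}).

(** With ['X] of weight 1, the total degree of [p] is below [d]: [msize] is the degree plus one, and
    truncated subtraction kills the coefficients from index [d] on. *)
Definition wsize (d : nat) p := forall k, (msize p`_k <= d - k)%N.

Lemma wsize_ge d p k : wsize d p -> (d <= k)%N -> p`_k = 0.
Proof.
by move=> /(_ k) h dk; apply/eqP; rewrite -msize_poly_eq0 -leqn0 (leq_trans h) // leqn0 subn_eq0.
Qed.

Lemma wsizeW d d' p : (d <= d')%N -> wsize d p -> wsize d' p.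
Proof. by move=> dd h k; apply: leq_trans (h k) _; rewrite leq_sub2r. Qed.

Lemma wsizeD d p q : wsize d p -> wsize d q -> wsize d (p + q).
Proof.
move=> hp hq k; rewrite coefD; apply: leq_trans (msizeD_le _ _) _.
by rewrite geq_max hp hq.
Qed.

Lemma wsizeN d p : wsize d p -> wsize d (- p).
Proof. by move=> hp k; rewrite coefN msizeN. Qed.

Lemma wsize_sum d (I : Type) (r : seq I) (P : pred I) (F : I -> {poly {mpoly K[s]}}) :
  (forall i, P i -> wsize d (F i)) -> wsize d (\sum_(i <- r | P i) F i).
Proof.
move=> h; elim/big_ind: _ => [k||//]; first by rewrite coef0 msize0.
by move=> p q; apply: wsizeD.
Qed.

Lemma msize_sum_le (n d : nat) (I : Type) (r : seq I) (P : pred I)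
    (F : I -> {mpoly K[n]}) :
  (forall i, P i -> msize (F i) <= d)%N -> (msize (\sum_(i <- r | P i) F i) <= d)%N.
Proof.
move=> h; elim/big_ind: _ => [||//]; first by rewrite msize0.
move=> p q hp hq; apply: leq_trans (msizeD_le _ _) _.
by rewrite geq_max hp hq.
Qed.

Lemma wsizeM d d' p q : wsize d.+1 p -> wsize d' q -> wsize (d + d') (p * q).
Proof.
move=> hp hq k; rewrite coefM; apply: msize_sum_le => i _.
have [->|p0] := eqVneq p`_i 0; first by rewrite mul0r msize0.
have [->|q0] := eqVneq q`_(k - i) 0; first by rewrite mulr0 msize0.
rewrite msizeM //; have := hp i; have := hq (k - i)%N.
have := ltn_ord i; move: p0 q0; rewrite -!msize_poly_eq0.
by move: (nat_of_ord i) => w; move: (msize p`_w) (msize q`_(k - w)) => u v; lia.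
Qed.

(** Total degree at most [d], with a constant as coefficient of ['X^d]; for nonzero [c], division by
    [p] is possible and respects the total degree. *)
Definition wtop (d : nat) (c : K) p := wsize d.+1 p /\ p`_d = c%:MP.

Lemma wtopM d d' c c' p q :
  wtop d c p -> wtop d' c' q -> wtop (d + d') (c * c') (p * q).
Proof.
move=> [hp cp] [hq cq]; split; first by rewrite -addnS; apply: wsizeM.
have hd : (d < (d + d').+1)%N by rewrite ltnS leq_addr.
rewrite coefM (bigD1 (Ordinal hd)) //= addKn cp cq -mpolyCM big1 ?addr0 // => i.
rewrite -val_eqE /= => ne.
case: (ltngtP d i) => [di|di|/eqP]; last by rewrite eq_sym (negbTE ne).
- by rewrite (wsize_ge hp) ?mul0r.
- by rewrite (wsize_ge hq) ?mulr0 //; lia.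
Qed.

Lemma wtop1 : wtop 0 1 1.
Proof.
split=> [k|]; last by rewrite coef1.
by rewrite coef1; case: k => [|k]; rewrite ?msize1 ?msize0.
Qed.

Lemma wtopX d c p k : wtop d c p -> wtop (d * k) (c ^+ k) (p ^+ k).
Proof.
move=> h; elim: k => [|k IH]; first by rewrite muln0 !expr0; apply: wtop1.
by rewrite mulnS !exprS; apply: wtopM.
Qed.

Lemma wsizeCM d c p : wsize d p -> wsize d (c%:MP%:P * p).
Proof.
move=> hp k; rewrite coefCM mul_mpolyC.
exact: leq_trans (msizeZ_le _ _) _.
Qed.

(* Euclidean division by [P], whose top coefficient is a nonzero constant. *)
Lemma wsize_reduce (T : comNzRingType) (ev : {rmorphism {poly {mpoly K[s]}} -> T})
    (d : nat) (c : K) (P : {poly {mpoly K[s]}}) :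
  c != 0 -> wtop d c P -> ev P = 0 ->
  forall e p, wsize e p -> exists q, [/\ (size q <= d)%N, wsize e q & ev q = ev p].
Proof.
move=> c0 [hP cP] evP e p; have [n] := ubnP (size p).
elim: n p => // n IH p; rewrite ltnS => sp hp.
have [sd|sd] := leqP (size p) d; first by exists p.
set k := (size p).-1.
have kd : (d <= k)%N by rewrite /k; lia.
pose r := (p`_k * (c^-1)%:MP)%:P * (P * 'X^(k - d)).
have cr i : r`_i = p`_k * (c^-1)%:MP * (if (i < k - d)%N then 0 else P`_(i - (k - d))).
  by rewrite coefCM coefMXn.
have hr : wsize e r.
  move=> i; rewrite cr; case: ltnP => h; first by rewrite mulr0 msize0.
  have [->|p0] := eqVneq p`_k 0; first by rewrite !mul0r msize0.
  rewrite mulrAC [_ * _%:MP]mulrC mul_mpolyC; apply: leq_trans (msizeZ_le _ _) _.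
  have [->|P0] := eqVneq P`_(i - (k - d)) 0; first by rewrite mulr0 msize0.
  rewrite msizeM //; have := hP (i - (k - d))%N; have := hp k.
  move: p0 P0; rewrite -!msize_poly_eq0.
  by move: (msize p`_k) (msize P`_(i - (k - d))) => u v; lia.
have [||q [q1 q2 q3]] := IH (p - r).
- have k1 : size p = k.+1 by rewrite /k prednK //; lia.
  rewrite k1 in sp; apply: leq_trans sp; rewrite ltnS.
  apply/leq_sizeP => j; rewrite leq_eqVlt => /orP[/eqP<-|kj]; rewrite coefB cr.
    rewrite ltnNge leq_subr /= subKn // cP -mulrA -mpolyCM mulVf // mulr1 subrr //.
  rewrite [p`_j]nth_default ?k1 // (wsize_ge hP); last by lia.
  by case: ifP; rewrite mulr0 subr0.
- by apply: wsizeD => //; apply: wsizeN.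
exists q; split=> //; rewrite q3 rmorphB /r !rmorphM evP mul0r mulr0 subr0 //.
Qed.

End Weighted.
End WeightedDegree.

Module NoetherNormalization.
Import mpoly MpolyFacts WeightedDegree.

Section Step.
Variables (K : numFieldType) (L : fieldType) (emb : {rmorphism K -> L}).

Lemma filtered_finite_refl N (x : 'I_N -> L) : filtered_finite emb x x.
Proof.
exists unit, (fun _ => 1) => G; exists (fun _ => G); split=> //.
by rewrite (big_pred1 tt) => [|[]//]; rewrite rmorph1 mulr1.
Qed.

Lemma msize_subst s N (l : 'I_s -> {mpoly K[N]}) (G : {mpoly K[s]}) :
  (forall i, msize (l i) <= 2)%N -> (msize (mmap (@mpolyC N K) l G) <= msize G)%N.
Proof.
move=> ls; have Fs m : (msize (mmap1 l m) <= (mdeg m).+1)%N.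
  rewrite mdegE; apply: (big_ind2 (fun p a => msize p <= a.+1)%N) => [|p a q b hp hq|i _]; first by rewrite msize1.
    have [->|p0] := eqVneq p 0; first by rewrite mul0r msize0.
    have [->|q0] := eqVneq q 0; first by rewrite mulr0 msize0.
    by rewrite msizeM //; move: hp hq; move: (msize p) (msize q) => u v; lia.
  elim: (m i) => [|k IH]; first by rewrite expr0 msize1.
  have [e|p0] := eqVneq (l i) 0; first by rewrite e expr0n /= msize0.
  rewrite exprS msizeM ?expf_neq0 //; move: (ls i) IH.
  by move: (msize (l i)) (msize (l i ^+ k)) => u v; lia.
rewrite /mmap big_seq; apply: msize_sum_le => m hm.
rewrite mul_mpolyC; apply: leq_trans (msizeZ_le _ _) _; apply: leq_trans (Fs m) _.
exact: msize_mdeg_lt.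
Qed.

Lemma mmap_lincomb s N (M : 'M[K]_(s, N)) (x : 'I_N -> L) (G : {mpoly K[s]}) :
  exists H : {mpoly K[N]}, (msize H <= msize G)%N /\
    mmap emb x H = mmap emb (lincomb emb M x) G.
Proof.
pose l i : {mpoly K[N]} := \sum_j M i j *: 'X_j.
have lE i : mmap emb x (l i) = lincomb emb M x i.
  rewrite raddf_sum; apply: eq_bigr => j _.
  by rewrite /= mmapZ mmapX mmap1U.
have ls i : (msize (l i) <= 2)%N.
  apply: msize_sum_le => j _; apply: leq_trans (msizeZ_le _ _) _.
  by rewrite msizeX mdeg1.
exists (mmap (@mpolyC N K) l G); split; first exact: msize_subst.
apply: (mpoly_rmorph_ext (f := mmap emb x \o mmap (@mpolyC N K) l)
   (g := mmap emb (lincomb emb M x))) => [c|i] /=; first by rewrite !mmapC.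
by rewrite !mmapX !mmap1U lE.
Qed.

(** The generators over [z] are products. Those over [y] are polynomials in linear forms in [x], so
    they can be rewritten as polynomials in [x]; only the degrees of the coefficients are
    controlled, and these do not grow at either stage. *)
Lemma filtered_finite_trans N s r (x : 'I_N -> L) (M : 'M[K]_(s, N)) (z : 'I_r -> L) :
  let y := lincomb emb M x in
  filtered_finite emb x y -> filtered_finite emb y z -> filtered_finite emb x z.
Proof.
move=> y [I [b hb]] [J [c hc]].
have /all_sig [c' hc'] : forall j, {H : {mpoly K[N]} | mmap emb x H = mmap emb y (c j)}.
  move=> j; apply: boolp.cid.
  by have [H [_ h]] := mmap_lincomb M x (c j); exists H.
exists (I * J)%type, (fun ij => c' ij.2 * b ij.1) => G.
have [C [sC eC]] := hb G.
have /all_sig [D hD] : forall i, {D | (forall j, msize (D j) <= msize (C i))%N /\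
      mmap emb y (C i) = \sum_j mmap emb z (D j) * mmap emb y (c j)}.
  by move=> i; apply: boolp.cid; apply: hc.
exists (fun ij => D ij.1 ij.2); split.
  by move=> [i j] /=; apply: leq_trans (sC i); apply: (hD i).1.
rewrite eC -(pair_bigA _ (fun i j => mmap emb z (D i j) * mmap emb x (c' j * b i))) /=.
apply: eq_bigr => i _; rewrite (hD i).2 mulr_suml; apply: eq_bigr => j _.
by rewrite rmorphM /= hc' mulrA.
Qed.

(** The change of variables [y_i = z_k + v_i T] for [i = lift j k], and [y_j = v_j T], with the
    variable of the outer polynomial ring as [T]. *)
Definition dir_subst s (j : 'I_s.+1) (v : 'I_s.+1 -> K) (i : 'I_s.+1) :
    {poly {mpoly K[s]}} :=
  (if unlift j i is Some k then 'X_k else 0)%:P + (v i)%:MP%:P * 'X.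

Lemma dir_subst_wtop s (j : 'I_s.+1) (v : 'I_s.+1 -> K) i :
  wtop 1 (v i) (dir_subst j v i).
Proof.
rewrite /dir_subst; split=> [k|]; rewrite coefD coefC coefCM coefX.
  case: k => [|[|k]] /=; rewrite ?mulr0 ?addr0 ?mulr1 ?msize0 ?add0r //.
    by case: (unlift j i) => [k|]; rewrite ?msizeX ?mdeg1 ?msize0.
  by rewrite msizeC leq_b1.
by rewrite /= add0r mulr1.
Qed.

(** Along a direction [v], a relation [f] of degree [d] becomes a polynomial in [T] whose
    coefficient of [T^d] is the value at [v] of the leading form of [f]. When this constant is
    nonzero, division by the relation leaves fewer than [d] powers of [T] and does not raise the
    total degree. *)
Lemma dependent_step s (y : 'I_s.+1 -> L) : ~ alg_indep emb y ->
  exists M : 'M[K]_(s, s.+1), filtered_finite emb y (lincomb emb M y).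
Proof.
move=> dep.
have [f [f0 fy]] : exists f, f != 0 /\ mmap emb y f = 0.
  apply: NNPP => H; apply: dep => f fy; apply: contraPeq H => f0 [].
  by exists f.
have sf : (0 < msize f)%N by rewrite lt0n msize_poly_eq0.
set d := (msize f).-1.
(* The leading form of [f]. *)
pose t : {mpoly K[s.+1]} := \sum_(m <- msupp f | mdeg m == d) f@_m *: 'X_[m].
have t0 : t != 0.
  have hm := mlead_supp f0.
  have dm : mdeg (mlead f) = d by rewrite /d -mlead_deg.
  apply/eqP => /(congr1 (mcoeff (mlead f))).
  rewrite mcoeff0 raddf_sum -big_filter (bigD1_seq (mlead f)) /=; last first.
  - exact/filter_uniq/msupp_uniq.
  - by rewrite mem_filter hm dm eqxx.
  rewrite mcoeffZ mcoeffX eqxx mulr1 big1_seq ?addr0 => [/eqP|m /andP[/negbTE mm _]].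
    by rewrite mcoeff_eq0 hm.
  by rewrite mcoeffZ mcoeffX mm mulr0.
have [v tv] := mpoly_nonvanishing t0.
(* A relation [f] of degree 0 would be a nonzero constant; so [d > 0], and the form [t] vanishes at
   the origin. *)
have [j vj] : exists j, v j != 0.
  apply: NNPP => H.
  have v0 i : v i = 0 by apply/eqP; apply: contra_notT H => ?; exists i.
  have d0 : d <> 0%N.
    move=> e; have := fy; rewrite (msize1_polyC (p := f)) /d; last first.
      by move: e; rewrite /d; move: (msize f) => u; lia.
    rewrite mmapC => /eqP; rewrite fmorph_eq0 => /eqP e0; case/eqP: f0.
    by rewrite (msize1_polyC (p := f)) ?e0 ?mpolyC0 //; move: e; rewrite /d; move: (msize f) => u; lia.
  case/eqP: tv; rewrite raddf_sum /= big1 // => m /eqP dm.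
  rewrite mevalZ mevalX.
  have [i mi] : exists i, m i != 0%N.
    apply: NNPP => H'; case: d0; rewrite -dm mdegE big1 // => i _.
    by apply/eqP; apply: contra_notT H' => ?; exists i.
  by rewrite (bigD1 i) //= v0 expr0n (negbTE mi) mul0r mulr0.
pose M : 'M[K]_(s, s.+1) := \matrix_(k, i) ((i == lift j k)%:R - (v (lift j k) / v j) * (i == j)%:R).
exists M; set z := lincomb emb M y.
have zE k : z k = y (lift j k) - emb (v (lift j k) / v j) * y j.
  rewrite /z /lincomb; under eq_bigr do rewrite mxE rmorphB rmorphM /= mulrBl.
  rewrite sumrB (bigD1 (lift j k)) //= eqxx rmorph1 mul1r big1; last first.
    by move=> i /negbTE ->; rewrite rmorph0 mul0r.
  rewrite addr0; congr (_ - _); rewrite (bigD1 j) //= eqxx rmorph1 mulr1 big1 ?addr0 //.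
  by move=> i /negbTE ->; rewrite rmorph0 mulr0 mul0r.
pose T := emb (v j)^-1 * y j.
pose emz : {rmorphism {mpoly K[s]} -> L} := mmap emb z.
have comT : commr_rmorph emz T by move=> a; apply: mulrC.
pose ev : {rmorphism {poly {mpoly K[s]}} -> L} := horner_morph comT.
have evX : ev 'X = T by rewrite /ev /= horner_morphX.
have evC a : ev a%:P = mmap emb z a by rewrite /ev /= horner_morphC.
pose Phi : {rmorphism {mpoly K[s.+1]} -> {poly {mpoly K[s]}}} :=
  mmap (polyC \o @mpolyC s K) (dir_subst j v).
have evPhi G : ev (Phi G) = mmap emb y G.
  apply: (mpoly_rmorph_ext (f := ev \o Phi) (g := mmap emb y)) => [c|i] /=.
    by rewrite /Phi /= !mmapC evC mmapC.
  rewrite /Phi /= !mmapX !mmap1U /dir_subst rmorphD rmorphM !evC evX mmapC.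
  case: unliftP => [k|] ->.
    by rewrite mmapX mmap1U zE /T mulrA -rmorphM subrK.
  by rewrite rmorph0 add0r /T mulrA -rmorphM divff // rmorph1 mul1r.
have PhiX m : wtop (mdeg m) (\prod_i v i ^+ m i) (Phi 'X_[m]).
  rewrite /Phi /= mmapX /mmap1 mdegE.
  apply: (big_rec3 (fun a b c => wtop a b c)) => [|i a b c _ h]; first exact: wtop1.
  by apply: wtopM => //; have := wtopX (m i) (dir_subst_wtop j v i); rewrite mul1n.
have PhiE G : Phi G = \sum_(m <- msupp G) (G@_m)%:MP%:P * Phi 'X_[m].
  rewrite {1}[G]mpolyE raddf_sum; apply: eq_bigr => m _.
  by rewrite /Phi /= mmapZ.
have Phis G : wsize (msize G) (Phi G).
  rewrite PhiE big_seq; apply: wsize_sum => m /msize_mdeg_lt hm.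
  by apply/wsizeCM/(wsizeW hm); case: (PhiX m).
have Phit : wtop d t.@[v] (Phi f).
  split; first by rewrite /d prednK.
  have -> : (t.@[v])%:MP = \sum_(m <- msupp f | mdeg m == d) 
      (f@_m)%:MP * (\prod_i v i ^+ m i)%:MP :> {mpoly K[s]}.
    rewrite /t (raddf_sum (meval v)) raddf_sum; apply: eq_bigr => m _ /=.
    by rewrite mevalZ mevalX mpolyCM.
  rewrite PhiE coef_sum [RHS]big_mkcond big_seq [RHS]big_seq.
  apply: eq_bigr => m /msize_mdeg_lt hm; rewrite coefCM.
  case: eqP => [e|ne]; first by have [_] := PhiX m; rewrite e => ->.
  have [h _] := PhiX m; rewrite (wsize_ge h) ?mulr0 //.
  by move: ne hm; rewrite /d; move: (mdeg m) (msize f) => a b; lia.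
(* The generators are the powers of [T = y_j / v_j] below the [d]-th. *)
exists 'I_d, (fun k : 'I_d => ((v j)^-1 *: 'X_j) ^+ k) => G.
have [q [q1 q2 q3]] := wsize_reduce tv Phit (etrans (evPhi f) fy) (Phis G).
exists (fun k : 'I_d => q`_k); split=> [k|]; first by apply: leq_trans (q2 k) (leq_subr _ _).
rewrite -evPhi -q3 /ev /= /horner_morph (horner_coef_wide _ (n := d)); last first.
  by rewrite (leq_trans (size_poly _ _)).
apply: eq_bigr => k _; rewrite coef_map /=; congr (_ * _).
by rewrite rmorphXn /= mmapZ mmapX mmap1U.
Qed.

Theorem noether_normalization N (x : 'I_N -> L) :
  exists (s : nat) (M : 'M[K]_(s, N)),
    alg_indep emb (lincomb emb M x) /\ filtered_finite emb x (lincomb emb M x).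
Proof.
suff H s (M : 'M[K]_(s, N)) : filtered_finite emb x (lincomb emb M x) ->
    exists (s : nat) (M : 'M[K]_(s, N)),
      alg_indep emb (lincomb emb M x) /\ filtered_finite emb x (lincomb emb M x).
  apply: (H N 1%:M).
  suff -> : lincomb emb 1%:M x = x by apply: filtered_finite_refl.
  apply: boolp.funext => i; rewrite /lincomb (bigD1 i) //= mxE eqxx rmorph1 mul1r.
  rewrite big1 ?addr0 // => j ji; rewrite mxE eq_sym (negbTE ji) rmorph0 mul0r //.
elim: s M => [|s IH] M hM.
  exists 0%N, M; split=> // f fy.
  have e : f = (f@_0)%:MP.
    apply: msize1_polyC; rewrite msizeE; apply/bigmax_leqP_seq => m _ _.
    by rewrite mdegE big_ord0.
  move: fy; rewrite e mmapC => /eqP; rewrite fmorph_eq0 => /eqP ->.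
  by rewrite mpolyC0.
case: (classic (alg_indep emb (lincomb emb M x))) => [|/dependent_step [M' h]].
  by exists s.+1, M.
apply: (IH (M' *m M)).
suff -> : lincomb emb (M' *m M) x = lincomb emb M' (lincomb emb M x).
  exact: filtered_finite_trans hM h.
apply: boolp.funext => i; rewrite /lincomb.
under eq_bigr do rewrite mxE rmorph_sum mulr_suml.
rewrite exchange_big; apply: eq_bigr => k _; rewrite mulr_sumr.
by apply: eq_bigr => j _; rewrite rmorphM mulrA.
Qed.

End Step.
End NoetherNormalization.

(** * Primitive element *)

Module Fractions.

Lemma fractionP (R : idomainType) (f : {fraction R}) :
  exists n d : R, d != 0 /\ f = FracField.tofrac n / FracField.tofrac d.
Proof.
elim/quotW: f => x; exists x.1, x.2; split; first exact: denom_ratioP.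
have d0 := denom_ratioP x.
apply: (mulIf (x := FracField.tofrac x.2)); first by rewrite tofrac_eq0.
rewrite divfK ?tofrac_eq0 //.
rewrite /FracField.tofrac; unlock.
rewrite -[LHS]/(FracField.mul _ _) -FracField.pi_mul; apply/eqmodP.
rewrite /= FracField.equivfE /FracField.mulf.
by rewrite !numden_Ratio ?mulr1 ?oner_eq0 // mulrC.
Qed.

Lemma fraction_lift (R : idomainType) (L : fieldType) (phi : {rmorphism R -> L}) :
  injective phi ->
  exists iota : {rmorphism {fraction R} -> L}, forall a, iota (FracField.tofrac a) = phi a.
Proof.
move=> inj; have phi0 a : a != 0 -> phi a != 0.
  by apply: contra_neq => e; apply: inj; rewrite e rmorph0.
have hz f : exists z, forall n d, d != 0 ->
    f = FracField.tofrac n / FracField.tofrac d -> z = phi n / phi d.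
  have [n [d [d0 ->]]] := fractionP f; exists (phi n / phi d) => n' d' d'0 /eqP.
  rewrite eqr_div ?tofrac_eq0 // -!rmorphM tofrac_eq => /eqP e; apply/eqP.
  by rewrite eqr_div ?phi0 // -!rmorphM e.
pose g f := sval (boolp.cid (hz f)).
have gE n d : d != 0 -> g (FracField.tofrac n / FracField.tofrac d) = phi n / phi d.
  by move=> d0; apply: (svalP (boolp.cid (hz _))).
have gT a : g (FracField.tofrac a) = phi a.
  by have := gE a 1 (oner_neq0 _); rewrite !rmorph1 !divr1.
have gB : zmod_morphism g.
  move=> f1 f2; have [n [d [d0 ->]]] := fractionP f1.
  have [n' [d' [d'0 ->]]] := fractionP f2.
  rewrite -mulNr -rmorphN addf_div ?tofrac_eq0 // -!rmorphM -rmorphD !gE ?mulf_neq0 //.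
  by rewrite rmorphD !rmorphM rmorphN -addf_div ?phi0 // !mulNr.
have gM : monoid_morphism g.
  split; first by have := gT 1; rewrite !rmorph1.
  move=> f1 f2; have [n [d [d0 ->]]] := fractionP f1.
  have [n' [d' [d'0 ->]]] := fractionP f2.
  by rewrite mulf_div -!rmorphM !gE ?mulf_neq0 // !rmorphM mulf_div.
pose hb1 := GRing.isZmodMorphism.Build _ _ g gB.
pose hb2 := GRing.isMonoidMorphism.Build _ _ g gM.
pose G : {rmorphism {fraction R} -> L} := HB.pack g hb1 hb2.
by exists G.
Qed.

Lemma clear_denominators (R : idomainType) (p : {poly {fraction R}}) :
  exists (d : R) (q : {poly R}), d != 0 /\
    FracField.tofrac d *: p = map_poly (@FracField.tofrac R) q.
Proof.
elim/poly_ind: p => [|p c [d [q [d0 e]]]].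
  by exists 1, 0; rewrite oner_neq0 scaler0 rmorph0.
have [a [b [b0 ->]]] := fractionP c.
exists (d * b), (b *: q * 'X + (d * a)%:P); split; first by rewrite mulf_neq0.
apply/polyP => i; rewrite coef_map !coefZ !coefD !coefMX !coefC.
case: i => [|i] /=; rewrite ?add0r ?addr0.
  by rewrite !rmorphM mulrACA divff ?tofrac_eq0 // mulr1.
have := congr1 (fun r : {poly _} => r`_i) e; rewrite coefZ coef_map /= => e1.
by rewrite coefZ !rmorphM /= -e1 mulrA; congr (_ * _); rewrite mulrC.
Qed.

(** Iterates the theorem for two generators. The integer coefficients make the primitive element the
    value at [x] of a polynomial over [K], and not merely over [K(y)]. *)
Lemma pchar0_PET_seq (F L : fieldType) (iota : {rmorphism F -> L}) (N : nat)
    (x : 'I_N -> L) : [pchar F] =i pred0 -> (forall i, algebraicOver iota (x i)) ->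
  exists c : 'I_N -> int,
    forall i, exists p, (map_poly iota p).[\sum_i x i *~ c i] = x i.
Proof.
move=> ch; elim: N x => [|N IH] x hx; first by exists (fun=> 0) => -[].
have [c hc] := IH (fun i => x (lift ord0 i)) (fun i => hx _).
set t := \sum_i _ in hc.
have [p1 p10 p1x] := hx ord0.
have [p2 p20 p2t] : algebraicOver iota t.
  rewrite /t; elim/big_ind: _ => [|a b|i _]; [exact: algebraic0|exact: algebraic_add|].
  have h n : algebraicOver iota (x (lift ord0 i) *+ n).
    by elim: n => [|n h]; rewrite ?mulr0n ?mulrS; [apply: algebraic0|apply: algebraic_add].
  case: (c i) => n; first exact: h.
  by rewrite NegzE mulrNz -pmulrn; apply: algebraic_opp; apply: h.
have [n [[q1 e1] [q2 e2]]] := pchar0_PET p10 p1x p20 p2t ch.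
have Dt : t *+ n - x ord0 =
    \sum_i x i *~ (if unlift ord0 i is Some j then c j *+ n else -1).
  rewrite big_ord_recl unlift_none mulrN1z addrC; congr (_ + _).
  rewrite /t -sumrMnl; apply: eq_bigr => i _; rewrite liftK.
  by rewrite !pmulrn -mulrzA mulrzz.
exists (fun i => if unlift ord0 i is Some j then c j *+ n else -1); rewrite -Dt => i.
case: (unliftP ord0 i) => [j ->|->]; last by exists q1.
have [q3 e3] := hc j; exists (q3 \Po q2).
by rewrite map_comp_poly horner_comp e2 e3.
Qed.

End Fractions.

(** * Coordinates of the polynomials in [x] with respect to the powers of a primitive element *)

Module Presentation.
Import mpoly MpolyFacts WeightedDegree NoetherNormalization Fractions.

Definition ev2 (A T : comNzRingType) (phi : {rmorphism A -> T}) (t : T) :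
    {rmorphism {poly A} -> T} :=
  horner_morph (fun a => mulrC t (phi a)).

Section Ev2.
Variables (A T : comNzRingType) (phi : {rmorphism A -> T}) (t : T).

Lemma ev2E p : ev2 phi t p = (map_poly phi p).[t]. Proof. by []. Qed.

Lemma ev2C c : ev2 phi t c%:P = phi c.
Proof. by rewrite ev2E map_polyC hornerC. Qed.

Lemma ev2X : ev2 phi t 'X = t.
Proof. by rewrite ev2E map_polyX hornerX. Qed.

Lemma ev2Z c p : ev2 phi t (c *: p) = phi c * ev2 phi t p.
Proof. by rewrite -mul_polyC rmorphM ev2C. Qed.

End Ev2.

(* [K(x)] is presented over the polynomial ring [K[y]] by the primitive element
   [theta = pr_th(x)], a root of [pr_P] of minimal degree; by [pr_coord] the
   common denominator [pr_q] serves for all polynomials in [x], and taking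
   coordinates raises degrees by at most [pr_B]. *)
Record presentation (K L : fieldType) (emb : {rmorphism K -> L}) (N : nat)
    (x : 'I_N -> L) := {
  pr_s : nat;
  pr_M : 'M[K]_(pr_s, N);
  pr_th : {mpoly K[N]};
  pr_P : {poly {mpoly K[pr_s]}};
  pr_q : {mpoly K[pr_s]};
  pr_B : nat;
  pr_y := lincomb emb pr_M x;
  pr_ev := ev2 (mmap emb pr_y) (mmap emb x pr_th);
  pr_indep : alg_indep emb pr_y;
  pr_P0 : pr_P != 0;
  pr_evP : pr_ev pr_P = 0;
  pr_min : forall H : {poly {mpoly K[pr_s]}}, pr_ev H = 0 ->
    exists k (Q : {poly {mpoly K[pr_s]}}), lead_coef pr_P ^+ k *: H = Q * pr_P;
  pr_coprime : forall H : {poly {mpoly K[pr_s]}}, pr_ev H <> 0 ->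
    exists (U V : {poly {mpoly K[pr_s]}}) (c : {mpoly K[pr_s]}), c != 0 /\ U * H + V * pr_P = c%:P;
  pr_q0 : pr_q != 0;
  pr_coord : forall G, exists D : {poly {mpoly K[pr_s]}},
    [/\ (size D < size pr_P)%N, (forall i, msize D`_i <= msize G + pr_B)%N &
        mmap emb pr_y pr_q * mmap emb x G = pr_ev D] }.

Arguments pr_y {K L emb N x} p.
Arguments pr_ev {K L emb N x} p.

Section Exists.
Variables (K : numFieldType) (L : fieldType) (emb : {rmorphism K -> L}).
Variables (N : nat) (x : 'I_N -> L) (s : nat) (y : 'I_s -> L).
Hypotheses (indep : alg_indep emb y) (fin : filtered_finite emb x y).

Let phi : {rmorphism {mpoly K[s]} -> L} := mmap emb y.

Lemma indep_inj : injective phi.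
Proof.
move=> a b e; apply/eqP; rewrite -subr_eq0; apply/eqP; apply: indep.
by rewrite rmorphB /= -/(phi a) -/(phi b) e subrr.
Qed.

Lemma indep_neq0 a : a != 0 -> phi a != 0.
Proof. by apply: contra_neq => e; apply: indep_inj; rewrite e rmorph0. Qed.

(** The first [r + 1] powers of the element are combinations of [r] generators, so their coefficient
    rows are dependent over the fraction field; a dependence is an algebraic equation. *)
Lemma finite_algebraic (iota : {rmorphism {fraction {mpoly K[s]}} -> L}) :
  (forall a, iota (FracField.tofrac a) = phi a) ->
  forall G, algebraicOver iota (mmap emb x G).
Proof.
move=> iE G; have [I [b hb]] := fin.
have /all_sig [C hC] : forall k, {C | mmap emb x (G ^+ k) =
    \sum_i mmap emb y (C i) * mmap emb x (b i)}.
  by move=> k; apply: boolp.cid; have [C [_ h]] := hb (G ^+ k); exists C.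
set r := #|I|.
pose W := \matrix_(k < r.+1, i < r) FracField.tofrac (C k (enum_val i)).
have : kermx W != 0.
  by rewrite kermx_eq0 /row_free neq_ltn ltnS rank_leq_col.
case/rowV0Pn => u /sub_kermxP uW u0.
exists (\poly_(k < r.+1) u 0 (inord k)).
  apply/eqP => e; case/eqP: u0; apply/rowP => k.
  have := congr1 (fun p : {poly _} => p`_k) e.
  by rewrite coef_poly ltn_ord coef0 inord_val mxE.
rewrite /root (horner_coef_wide _ (n := r.+1)); last first.
  by rewrite (leq_trans (size_poly _ _)) // size_poly.
under eq_bigr => k _ do rewrite coef_map coef_poly ltn_ord inord_val
   -rmorphXn /= hC mulr_sumr.
rewrite exchange_big /= big1 // => i _.
under eq_bigr => k _ do rewrite mulrA -[mmap emb y _]/(phi _) -iE -rmorphM.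
rewrite -mulr_suml -rmorph_sum.
have := congr1 (fun v : 'rV__ => v 0 (enum_rank i)) uW; rewrite !mxE => e.
suff -> : \sum_(k < r.+1) u 0 k * FracField.tofrac (C k i) = 0.
  by rewrite rmorph0 mul0r.
by rewrite -[RHS]e; apply: eq_bigr => k _; rewrite mxE enum_rankK.
Qed.

Lemma minimal_annihilator (T : comNzRingType) (ev : {rmorphism {poly {mpoly K[s]}} -> T}) p :
  p != 0 -> ev p = 0 -> exists P, [/\ P != 0, ev P = 0 &
    forall H, ev H = 0 -> (size H < size P)%N -> H = 0].
Proof.
have [n] := ubnP (size p); elim: n p => // n IH p; rewrite ltnS => sp p0 ep.
case: (classic (exists H, [/\ ev H = 0, (size H < size p)%N & H != 0])).
  by case=> H [eH sH H0]; apply: (IH H) => //; apply: leq_trans sH _.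
move=> H; exists p; split=> // h eh sh; apply/eqP; apply: contra_notT H => h0.
by exists h.
Qed.

(** Pseudo-division, as the coefficients only form a domain: the remainder vanishes at [t] and is
    shorter than [P], hence zero. *)
Lemma minimal_division (t : L) (P : {poly {mpoly K[s]}}) :
  P != 0 -> ev2 phi t P = 0 ->
  (forall H, ev2 phi t H = 0 -> (size H < size P)%N -> H = 0) ->
  forall H : {poly {mpoly K[s]}}, ev2 phi t H = 0 ->
  exists k (Q : {poly {mpoly K[s]}}), lead_coef P ^+ k *: H = Q * P.
Proof.
move=> P0 eP mP H eH; exists (Pdiv.Idomain.scalp H P), (Pdiv.Idomain.divp H P).
rewrite Pdiv.Idomain.divp_eq [Pdiv.Idomain.modp H P]mP ?addr0 //.
  have := congr1 (ev2 phi t) (Pdiv.Idomain.divp_eq H P).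
  by rewrite ev2Z eH mulr0 rmorphD rmorphM eP mulr0 add0r.
by rewrite Pdiv.Idomain.ltn_modp.
Qed.

(** Takes the place of irreducibility of [P]. The gcd of [H] and [P] cannot vanish at [t], since [H]
    does not; so its cofactor in [P] vanishes there and, by minimality, is as long as [P]. The gcd
    is then a constant. *)
Lemma minimal_coprime (t : L) (P : {poly {mpoly K[s]}}) :
  P != 0 -> ev2 phi t P = 0 ->
  (forall H, ev2 phi t H = 0 -> (size H < size P)%N -> H = 0) ->
  forall H : {poly {mpoly K[s]}}, ev2 phi t H <> 0 ->
  exists (U V : {poly {mpoly K[s]}}) (c : {mpoly K[s]}), c != 0 /\ U * H + V * P = c%:P.
Proof.
move=> P0 eP mP H eH.
suff /Pdiv.Idomain.Bezout_coprimepP [u /Pdiv.Idomain.eqpP [[c1 c2] /=]] :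
    Pdiv.Idomain.coprimep H P.
  move=> /andP[c10 c20] e; exists (c1 *: u.1), (c1 *: u.2), c2; split=> //.
  by rewrite -!scalerAl -scalerDr e -mul_polyC mulr1.
set g := Pdiv.Idomain.gcdp H P.
have /Pdiv.Idomain.dvdpP [[c r] /= c0 er] := Pdiv.Idomain.dvdp_gcdr H P.
have /Pdiv.Idomain.dvdpP [[c' r'] /= c'0 er'] := Pdiv.Idomain.dvdp_gcdl H P.
have g0 : ev2 phi t g != 0.
  apply/eqP => eg; have := congr1 (ev2 phi t) er'; rewrite ev2Z rmorphM eg mulr0.
  by move/eqP; rewrite mulf_eq0 (negbTE (indep_neq0 c'0)) /= => /eqP.
have er0 : ev2 phi t r = 0.
  have := congr1 (ev2 phi t) er; rewrite ev2Z eP mulr0 rmorphM => /esym/eqP.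
  by rewrite mulf_eq0 (negbTE g0) orbF => /eqP.
have r0 : r != 0.
  apply/eqP => r0; move: er; rewrite r0 mul0r => /eqP.
  by rewrite scale_poly_eq0 (negbTE c0) (negbTE P0).
have g0' : g != 0 by apply: contraNneq g0 => ->; rewrite rmorph0.
have rP : (size P <= size r)%N.
  by rewrite leqNgt; apply/negP => h; case/eqP: r0; apply: mP.
have := congr1 (fun p : {poly _} => size p) er.
rewrite /= size_scale // size_mul // -/g => e.
rewrite /Pdiv.Idomain.coprimep -/g; move: rP e g0'; rewrite -size_poly_eq0.
by case: (size g) => [//|k] h1 h2 _; move: h1; rewrite h2 addnS /=; lia.
Qed.

Lemma ev2_reduce (t : L) (P : {poly {mpoly K[s]}}) : P != 0 -> ev2 phi t P = 0 ->
  forall H, exists c (D : {poly {mpoly K[s]}}), [/\ c != 0, (size D < size P)%N & phi c * ev2 phi t H = ev2 phi t D].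
Proof.
move=> P0 eP H; exists (lead_coef P ^+ Pdiv.Idomain.scalp H P), (Pdiv.Idomain.modp H P).
split; first by rewrite expf_neq0 // lead_coef_eq0.
  by rewrite Pdiv.Idomain.ltn_modp.
rewrite -ev2Z Pdiv.Idomain.divp_eq rmorphD rmorphM eP mulr0 add0r //.
Qed.

End Exists.

Theorem exists_presentation (K : numFieldType) (L : fieldType)
  (emb : {rmorphism K -> L}) (N : nat) (x : 'I_N -> L) : inhabited (presentation emb x).
Proof.
have [s [M [indep fin]]] := noether_normalization emb x.
set y := lincomb emb M x in indep fin.
pose phi : {rmorphism {mpoly K[s]} -> L} := mmap emb y.
have [iota iE] := fraction_lift (indep_inj indep).
have alg := finite_algebraic fin iE.
have ch : [pchar {fraction {mpoly K[s]}}] =i pred0.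
  apply/pcharf0P => n.
  rewrite -(rmorph_nat (FracField.tofrac (R := {mpoly K[s]}))) tofrac_eq0.
  by rewrite -mpolyC_nat mpolyC_eq0 pnatr_eq0.
have [|c hc] := pchar0_PET_seq (iota := iota) (x := x) ch.
  by move=> i; have := alg 'X_i; rewrite mmapX mmap1U.
pose th : {mpoly K[N]} := \sum_i 'X_i *~ c i.
set t := mmap emb x th.
have tE : t = \sum_i x i *~ c i.
  rewrite /t /th rmorph_sum; apply: eq_bigr => i _.
  by rewrite rmorphMz /= mmapX mmap1U.
rewrite -tE in hc.
have /all_sig [p hp] : forall i, {p | (map_poly iota p).[t] = x i}.
  by move=> i; apply: boolp.cid.
(* The denominator [c] still depends on [G]. *)
have gen G : exists c H, c != 0 /\ phi c * mmap emb x G = ev2 phi t H.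
  pose g := mmap (polyC \o @FracField.tofrac {mpoly K[s]} \o @mpolyC s K) p : {rmorphism {mpoly K[N]} -> _}.
  have gE : (map_poly iota (g G)).[t] = mmap emb x G.
    apply: (mpoly_rmorph_ext (f := ev2 iota t \o g) (g := mmap emb x)) => [a|i] /=.
      by rewrite /g /= mmapC /= ev2C /= iE /phi /= !mmapC.
    by rewrite /g /= !mmapX !mmap1U ev2E hp.
  have [d [q [d0 e]]] := clear_denominators (g G).
  exists d, q; split=> //; rewrite -gE -[_.[t]]/(ev2 iota t _) -iE -ev2Z e !ev2E.
  rewrite -map_poly_comp /=; congr (_.[t]); apply: eq_map_poly => a /=; exact: iE.
have [p1 [p10 p1t]] : exists p, p != 0 /\ ev2 phi t p = 0.
  have [p1 p10 /eqP p1t] := alg th; have [d [q [d0 e]]] := clear_denominators p1.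
  exists q; split.
    apply: contraNneq p10 => q0; move: e; rewrite q0 rmorph0 => /eqP.
    by rewrite scale_poly_eq0 tofrac_eq0 (negbTE d0).
  have -> : ev2 phi t q = ev2 iota t (map_poly (@FracField.tofrac _) q).
    rewrite !ev2E -map_poly_comp /=; congr (_.[t]); apply: eq_map_poly => a /=.
    by rewrite iE.
  by rewrite -e ev2Z ev2E p1t mulr0.
have [P [P0 eP mP]] := minimal_annihilator p10 p1t.
have [I [b hb]] := fin.
have /all_sig [d hd] : forall i, {cD : {mpoly K[s]} * {poly {mpoly K[s]}} | [/\ cD.1 != 0, (size cD.2 < size P)%N &
   phi cD.1 * mmap emb x (b i) = ev2 phi t cD.2]}.
  move=> i; apply: boolp.cid; have [c1 [H [c10 e1]]] := gen (b i).
  have [c2 [D [c20 sD e2]]] := ev2_reduce P0 eP H.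
  exists (c2 * c1, D); split=> //=; first by rewrite mulf_neq0.
  by rewrite rmorphM -mulrA e1.
(* A common denominator of the finitely many generators serves every [G], whose coefficients [C i]
   are polynomials in [y] of degree at most that of [G]. For the same reason the coordinates of the
   generators alone determine the loss of degree [B]. *)
pose q := \prod_i (d i).1.
pose Dq i : {poly {mpoly K[s]}} := (\prod_(j | j != i) (d j).1) *: (d i).2.
have Dqs i : (size (Dq i) < size P)%N.
  by apply: leq_ltn_trans (size_scale_leq _ _) _; case: (hd i).
have Dqe i : phi q * mmap emb x (b i) = ev2 phi t (Dq i).
  rewrite /q (bigD1 i) //= rmorphM -mulrA mulrCA; have [_ _ ->] := hd i.
  by rewrite ev2Z.
pose B := (\sum_i \sum_(k < size P) msize (Dq i)`_k)%N.
exists; refine (@Build_presentation _ _ emb N x s M th P q B indep P0 eP _ _ _ _).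
- exact: minimal_division P0 eP mP.
- move=> H eH. have [U [V [c0 [c00 e]]]]:= minimal_coprime indep P0 eP mP eH. by exists U, V, c0.
- by rewrite prodf_seq_neq0; apply/allP => i _; case: (hd i).
move=> G; have [C [sC eC]] := hb G.
exists (\sum_i C i *: Dq i); split.
- have P1 : (0 < size P)%N by rewrite size_poly_gt0.
  apply: leq_ltn_trans (size_sum _ _ _) _.
  rewrite -(prednK P1) ltnS; apply/bigmax_leqP => i _.
  apply: leq_trans (size_scale_leq _ _) _.
  by rewrite -ltnS (prednK P1).
- move=> k; rewrite coef_sum; apply: msize_sum_le => i _; rewrite coefZ.
  have [->|C0] := eqVneq (C i) 0; first by rewrite mul0r msize0.
  have [->|D0] := eqVneq (Dq i)`_k 0; first by rewrite mulr0 msize0.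
  have kP : (k < size P)%N.
    rewrite ltnNge; apply: contraNN D0 => kP; rewrite nth_default //.
    exact: leq_trans (ltnW (Dqs i)) kP.
  have h : (msize (Dq i)`_k <= B)%N.
    by rewrite /B (bigD1 i) //= (bigD1 (Ordinal kP)) //= -addnA leq_addr.
  rewrite msizeM //; move: (sC i) h.
  by move: (msize _) (msize _) (msize _) B => *; lia.
rewrite -[mmap emb _ q]/(phi q) eC mulr_sumr rmorph_sum; apply: eq_bigr => i _.
by rewrite mulrCA Dqe /=; apply/esym; apply: ev2Z.
Qed.

End Presentation.

(** * Bound for the Hilbert function *)

Module VanishingOrder.
Import mpoly MpolyFacts WeightedDegree NoetherNormalization Fractions Presentation.

Section Order.
Variables (K : numFieldType) (s : nat) (a : 'I_s -> K).
Implicit Types f g q : {mpoly K[s]}.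

Definition shift (b : 'I_s -> K) : {rmorphism {mpoly K[s]} -> {mpoly K[s]}} :=
  mmap (@mpolyC s K) (fun i => 'X_i + (b i)%:MP).

Definition vanishes r f := forall m, (mdeg m < r)%N -> (shift a f)@_m = 0.

Lemma shiftC b c : shift b c%:MP = c%:MP. Proof. by rewrite /shift /= mmapC. Qed.

Lemma shiftX b i : shift b 'X_i = 'X_i + (b i)%:MP.
Proof. by rewrite /shift /= mmapX mmap1U. Qed.

Lemma shiftK b : cancel (shift b) (shift (fun i => - b i)).
Proof.
apply: (mpoly_rmorph_ext (f := shift _ \o shift b) (g := idfun)) => [c|i] /=.
  by rewrite !shiftC.
by rewrite shiftX rmorphD shiftX shiftC mpolyCN subrK.
Qed.

Lemma msize_shift b f : (msize (shift b f) <= msize f)%N.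
Proof.
apply: msize_subst => i; apply: leq_trans (msizeD_le _ _) _.
by rewrite geq_max msizeX mdeg1 msizeC; case: (_ != _).
Qed.

Lemma shift_coef0 f : (shift a f)@_0 = f.@[a].
Proof.
apply: (mpoly_rmorph_ext (f := mcoeff 0 \o shift a) (g := meval a)) => [c|i] /=.
  by rewrite shiftC mcoeffC eqxx mulr1 mevalC.
rewrite shiftX mcoeffD mcoeffX mcoeffC eqxx mulr1 mevalXU.
by rewrite mnm1_eq0 add0r.
Qed.

Lemma vanishes0 r : vanishes r 0.
Proof. by move=> m _; rewrite rmorph0 mcoeff0. Qed.

Lemma vanishesD r f g : vanishes r f -> vanishes r g -> vanishes r (f + g).
Proof. by move=> hf hg m hm; rewrite rmorphD mcoeffD hf ?hg ?addr0. Qed.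

Lemma vanishes_sum r (I : Type) (l : seq I) (P : pred I) (F : I -> {mpoly K[s]}) :
  (forall i, P i -> vanishes r (F i)) -> vanishes r (\sum_(i <- l | P i) F i).
Proof.
by move=> h; apply: (big_ind (vanishes r)); [exact: vanishes0|exact: vanishesD|exact: h].
Qed.

Lemma vanishesM r r' f g : vanishes r f -> vanishes r' g -> vanishes (r + r') (f * g).
Proof.
move=> hf hg m hm; rewrite rmorphM mcoeffM big1 // => k /eqP e.
have {}hm : (mdeg k.1 + mdeg k.2 < r + r')%N by rewrite -mdegD -e.
have [h|h] := ltnP (mdeg k.1) r; first by rewrite hf ?mul0r.
rewrite [X in _ * X]hg ?mulr0 //; move: hm h.
by move: (mdeg k.1) (mdeg k.2) => u v; lia.
Qed.

Lemma vanishesMl r f g : vanishes r g -> vanishes r (f * g).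
Proof. by move=> h; rewrite -[r]add0n; apply: vanishesM. Qed.

Lemma vanishesN r f : vanishes r f -> vanishes r (- f).
Proof. by rewrite -mulN1r; apply: vanishesMl. Qed.

(** [q] is a unit among the power series at [a]: by induction on the degree of [m], the coefficient
    of [m] in [q * f] reduces to [q(a)] times that in [f]. *)
Lemma vanishes_cancel r q f : q.@[a] != 0 -> vanishes r (q * f) -> vanishes r f.
Proof.
move=> q0 h m; have [n] := ubnP (mdeg m); elim: n m => // n IH m; rewrite ltnS => mn hm.
have := h m hm; rewrite rmorphM mcoeffM.
have h0 : (mdeg (0 : 'X_{1..s}) < (mdeg m).+1)%N by rewrite mdeg0.
have hm' : (mdeg m < (mdeg m).+1)%N by [].
rewrite (bigD1 (BMultinom h0, BMultinom hm')) /=; last by rewrite add0m.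
rewrite shift_coef0 big1 => [|[k1 k2] /= /andP[/eqP e ne]].
  by rewrite addr0 => /eqP; rewrite mulf_eq0 (negbTE q0) => /eqP.
have em : mdeg m = (mdeg k1 + mdeg k2)%N by rewrite -mdegD -e.
have k10 : mdeg k1 != 0%N.
  rewrite mdeg_eq0; apply: contraNneq ne => k0.
  have mk : m = bmnm k2 := etrans e (etrans (congr1 (fun u => u + bmnm k2)%MM k0) (add0m _)).
  by apply/eqP; congr (_, _); apply/val_inj.
have h1 : (mdeg k2 < mdeg k1 + mdeg k2)%N.
  by rewrite -[X in (X < _)%N]add0n ltn_add2r lt0n.
have {}h1 : (mdeg k2 < mdeg m)%N := eq_ind _ (fun u => mdeg k2 < u)%N h1 _ (esym em).
by rewrite (IH k2) ?mulr0 //; [apply: leq_trans h1 mn|apply: ltn_trans h1 hm].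
Qed.

Lemma vanishes_eq0 r f : (msize f <= r)%N -> vanishes r f -> f = 0.
Proof.
move=> sf h; apply: (can_inj (shiftK a)); rewrite (rmorph0 (shift a)).
apply/mpolyP => m; rewrite mcoeff0; have [hm|hm] := ltnP (mdeg m) r; first exact: h.
apply/eqP; rewrite mcoeff_eq0; apply: msize_mdeg_ge.
by apply: leq_trans hm; apply: leq_trans (msize_shift _ _) _.
Qed.

Definition pvanishes r (p : {poly {mpoly K[s]}}) := forall i, vanishes r p`_i.

Lemma pvanishesM r r' p p' : pvanishes r p -> pvanishes r' p' -> pvanishes (r + r') (p * p').
Proof. by move=> h h' i; rewrite coefM; apply: vanishes_sum => j _; apply: vanishesM. Qed.

Lemma pvanishesX r p k : pvanishes r p -> pvanishes (k * r) (p ^+ k).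
Proof.
move=> h; elim: k => [|k IH]; first by move=> i; rewrite mul0n.
by rewrite exprS mulSn; apply: pvanishesM.
Qed.

(** Each step of pseudo-division replaces the coefficients by combinations of coefficients of [p],
    which all vanish to order [r]; reduction to coordinates therefore keeps the order. *)
Lemma pvanishes_reduce (T : comNzRingType) (ev : {rmorphism {poly {mpoly K[s]}} -> T}) r
    (P : {poly {mpoly K[s]}}) :
  P != 0 -> ev P = 0 -> forall p, pvanishes r p ->
  exists k (R : {poly {mpoly K[s]}}),
  [/\ (size R < size P)%N, pvanishes r R & ev (lead_coef P ^+ k *: p) = ev R].
Proof.
move=> P0 eP p; have [n] := ubnP (size p); elim: n p => // n IH p; rewrite ltnS => sp hp.
have [h|h] := ltnP (size p) (size P); first by exists 0%N, p; rewrite expr0 scale1r.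
have P1 : (0 < size P)%N by rewrite size_poly_gt0.
pose j := (size p - size P)%N.
pose R := lead_coef P *: p - (lead_coef p *: 'X^j) * P.
have Rc i : R`_i = lead_coef P * p`_i - lead_coef p * (if (i < j)%N then 0 else P`_(i - j)).
  by rewrite coefB coefZ -scalerAl coefZ coefXnM.
have sR : (size R < size p)%N.
  rewrite -(prednK (leq_trans P1 h)) ltnS; apply/leq_sizeP => i.
  rewrite leq_eqVlt => /orP[/eqP<-|hi]; rewrite Rc.
    have [-> ->] : ((size p).-1 < j)%N = false /\ ((size p).-1 - j)%N = (size P).-1.
      by rewrite /j; move: (size p) (size P) P1 h => u v; lia.
    by rewrite -!lead_coefE mulrC subrr.
  rewrite nth_default; last by move: hi; move: (size p) => u; lia.
  rewrite [P`_ _]nth_default; last by rewrite /j; move: hi h; move: (size p) (size P) => u v; lia.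
  by case: ifP; rewrite !mulr0 subr0.
have [||k [R' [s1 h1 e1]]] := IH R.
- by apply: leq_trans sR sp.
- move=> i; rewrite Rc; apply: vanishesD; first exact/vanishesMl/hp.
  by apply: vanishesN; rewrite mulrC; apply/vanishesMl/hp.
exists k.+1, R'; split=> //; rewrite -e1 exprSr -scalerA /R.
by rewrite !linearB /= rmorphB -[X in _ - ev X]mul_polyC !rmorphM eP !mulr0 subr0.
Qed.

End Order.

End VanishingOrder.

Module HilbertBound.
Import mpoly MpolyFacts WeightedDegree NoetherNormalization Fractions Presentation VanishingOrder.

Section Bound.
Variables (K : numFieldType) (L : fieldType) (emb : {rmorphism K -> L}).
Variables (N : nat) (x : 'I_N -> L) (pr : presentation emb x).
Local Notation s := (pr_s pr).
Local Notation P := (pr_P pr).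

Lemma pr_evZ (c : {mpoly K[s]}) p :
  pr_ev pr (c *: p) = mmap emb (pr_y pr) c * pr_ev pr p.
Proof. exact: ev2Z. Qed.

(** The degree of [K(x)] over [K(y)]. *)
Definition pr_e := (size P).-1.

Lemma pr_small (H : {poly {mpoly K[s]}}) : pr_ev pr H = 0 -> (size H < size P)%N -> H = 0.
Proof.
move=> eH sH; have [k [Q e]] := pr_min eH; apply/eqP; apply: contraTT sH => H0.
have l0 : lead_coef P ^+ k != 0 by rewrite expf_neq0 // lead_coef_eq0 pr_P0.
have Q0 : Q != 0.
  apply/eqP => Q0; move: e; rewrite Q0 mul0r => /eqP.
  by rewrite scale_poly_eq0 (negbTE l0) (negbTE H0).
have := congr1 (fun p : {poly _} => size p) e.
rewrite /= size_scale // size_mul ?pr_P0 // => ->.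
by rewrite -leqNgt; move: Q0; rewrite -size_poly_eq0; case: (size Q) => // k' _; rewrite addSn leq_addl.
Qed.

Lemma card_bmnm n m : (#|{: 'X_{1..n < m.+1}}| <= m.+1 ^ n)%N.
Proof.
pose f (k : 'X_{1..n < m.+1}) : {ffun 'I_n -> 'I_m.+1} := [ffun i => inord (k i)].
have inj : injective f.
  move=> k1 k2 e; apply/val_inj/mnmP => i.
  have b (k : 'X_{1..n < m.+1}) : (k i < m.+1)%N.
    by apply: leq_ltn_trans (bmdeg k); rewrite mdegE (bigD1 i) //= leq_addr.
  have := congr1 (fun g : {ffun _ -> _} => nat_of_ord (g i)) e.
  by rewrite !ffunE !inordK.
by have := leq_card f inj; rewrite card_ffun !card_ord.
Qed.

(* A combination whose coordinates vanish to order [m+1] at a good point is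
   zero: the coordinates of its [S]-th power have degree at most [S m + B] but
   vanish to order [S (m+1)]. *)
Theorem hilbert_bound m r (g : 'I_r -> {mpoly K[N]}) :
  (forall i, msize (g i) <= m.+1)%N -> (pr_e * m.+1 ^ s < r)%N ->
  exists c : 'rV[K]_r, c != 0 /\ mmap emb x (\sum_i c 0 i *: g i) = 0.
Proof.
move=> gm er.
have q0 : lead_coef P * pr_q pr != 0.
  by rewrite mulf_neq0 ?pr_q0 // lead_coef_eq0 pr_P0.
have [a] := mpoly_nonvanishing q0; rewrite mevalM mulf_eq0 negb_or => /andP[la qa].
have /all_sig [D hD] : forall i, {D : {poly {mpoly K[s]}} |
    (size D < size P)%N /\ mmap emb (pr_y pr) (pr_q pr) * mmap emb x (g i) = pr_ev pr D}.
  by move=> i; apply: boolp.cid; have [D [h1 _ h2]] := pr_coord pr (g i); exists D.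
pose J := ('I_pr_e * 'X_{1..s < m.+1})%type.
(* One column for each Taylor coefficient at [a], up to degree [m], of each of the [e] coordinates:
   fewer columns than rows, so some combination of the [g i] has coordinates vanishing to order
   [m + 1]. *)
pose W := \matrix_(i < r, j < #|{: J}|)
  (shift a (D i)`_(enum_val j).1)@_((enum_val j).2).
have : kermx W != 0.
  rewrite kermx_eq0 /row_free neq_ltn; apply/orP; left.
  apply: leq_ltn_trans (rank_leq_col _) _; apply: leq_ltn_trans er.
  by rewrite card_prod card_ord leq_mul2l card_bmnm orbT.
case/rowV0Pn => c /sub_kermxP cW c0; exists c; split=> //.
set G : {mpoly K[N]} := \sum_i c 0 i *: g i.
pose Dc : {poly {mpoly K[s]}} := \sum_i (c 0 i)%:MP *: D i.
have Dcs : (size Dc < size P)%N.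
  have P1 : (0 < size P)%N by rewrite size_poly_gt0 pr_P0.
  apply: leq_ltn_trans (size_sum _ _ _) _.
  rewrite -(prednK P1) ltnS; apply/bigmax_leqP => i _.
  apply: leq_trans (size_scale_leq _ _) _.
  by rewrite -ltnS (prednK P1); case: (hD i).
have Dce : mmap emb (pr_y pr) (pr_q pr) * mmap emb x G = pr_ev pr Dc.
  rewrite /G /Dc !rmorph_sum mulr_sumr; apply: eq_bigr => i _ /=.
  by rewrite mmapZ mulrCA (hD i).2 pr_evZ /= mmapC.
have Dcv : pvanishes a m.+1 Dc.
  move=> i k hk; have [hi|hi] := ltnP i pr_e; last first.
    rewrite nth_default ?rmorph0 ?mcoeff0 //; apply: leq_trans hi.
    by rewrite -ltnS /pr_e (ltn_predK Dcs).
  pose j := enum_rank ((Ordinal hi, BMultinom hk) : J).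
  have := congr1 (fun v : 'rV__ => v 0 j) cW; rewrite !mxE => e.
  rewrite -[RHS]e coef_sum rmorph_sum raddf_sum; apply: eq_bigr => i' _.
  by rewrite mxE /j enum_rankK /= coefZ rmorphM /= shiftC mul_mpolyC mcoeffZ.
(* The exponent makes [S * m + 1 + B] equal to [S * (m + 1)]: the bound on the sizes of the
   coordinates then meets their order of vanishing. *)
set S := (pr_B pr).+1.
have [k [R [Rs Rv Re]]] := pvanishes_reduce (pr_P0 pr) (pr_evP pr) (pvanishesX (k := S) Dcv).
have [E [Es Em Ee]] := pr_coord pr (G ^+ S).
(* Coordinates are unique: [E] comes from [G ^+ S] and [R] from the reduction of [Dc ^+ S], and
   after scaling both evaluate to the same multiple of [G ^+ S] at [x]. *)
have H0 : lead_coef P ^+ k *: (pr_q pr ^+ S *: E) - pr_q pr *: R = 0.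
  apply: pr_small.
    have e1 : pr_ev pr (Dc ^+ S) = (mmap emb (pr_y pr) (pr_q pr) * mmap emb x G) ^+ S.
      by rewrite rmorphXn Dce.
    rewrite rmorphB !pr_evZ -Re -Ee pr_evZ e1 exprMn rmorphXn /=.
    rewrite (rmorphXn (mmap emb (pr_y pr)) S) (rmorphXn (mmap emb x)) /=.
    by apply/eqP; rewrite subr_eq0; apply/eqP; ring.
  apply: leq_ltn_trans (size_polyD _ _) _; rewrite size_polyN gtn_max.
  rewrite (leq_ltn_trans (size_scale_leq _ _)) //=; last first.
    by rewrite (leq_ltn_trans (size_scale_leq _ _)).
  by rewrite (leq_ltn_trans (size_scale_leq _ _)).
have Gs : (msize (G ^+ S) <= S * m + 1)%N.
  have Gm : (msize G <= m.+1)%N.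
    by apply: msize_sum_le => i _; apply: leq_trans (msizeZ_le _ _) (gm i).
  elim: (S) => [|S' IH]; first by rewrite expr0 msize1.
  have [->|G0] := eqVneq G 0; first by rewrite expr0n msize0.
  rewrite exprS msizeM ?expf_neq0 // mulSn; move: Gm IH.
  by move: (msize G) (msize (G ^+ S')) => u v; lia.
have E0 : E = 0.
  apply/polyP => i; rewrite coef0.
  apply: (@vanishes_eq0 _ _ a (S * m.+1)).
    by apply: leq_trans (Em i) _; move: Gs; rewrite /S; move: (msize _) => u; lia.
  apply: (@vanishes_cancel _ _ _ _ (lead_coef P ^+ k * pr_q pr ^+ S)).
    by rewrite mevalM !rmorphXn mulf_neq0 // expf_neq0.
  have := congr1 (fun p : {poly _} => p`_i) H0.
  rewrite coefB !coefZ coef0 mulrA => /eqP; rewrite subr_eq0 => /eqP ->.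
  exact/vanishesMl/Rv.
move: Ee; rewrite E0 rmorph0 => /eqP; rewrite mulf_eq0.
rewrite (negbTE (indep_neq0 (@pr_indep _ _ _ _ _ pr) (pr_q0 pr))) /= rmorphXn expf_eq0 /=.
by move/eqP.
Qed.

End Bound.
End HilbertBound.

(** * Specialization and fibres *)

Module Specialization.
Import mpoly MpolyFacts WeightedDegree NoetherNormalization Fractions Presentation HilbertBound.

Section Generic.
Variables (K : numFieldType) (L : fieldType) (emb : {rmorphism K -> L}).
Variables (N : nat) (x : 'I_N -> L) (pr : presentation emb x).
Local Notation s := (pr_s pr).
Local Notation P := (pr_P pr).
Local Notation q := (pr_q pr).

Definition pr_num (G : {mpoly K[N]}) : {poly {mpoly K[s]}} :=
  sval (boolp.cid (pr_coord pr G)).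

Lemma pr_numP G : pr_ev pr (pr_num G) = mmap emb (pr_y pr) q * mmap emb x G.
Proof. by rewrite /pr_num; case: boolp.cid => D /= []. Qed.

Lemma pr_evC c : pr_ev pr c%:P = mmap emb (pr_y pr) c.
Proof. exact: ev2C. Qed.

Lemma pr_evX : pr_ev pr 'X = mmap emb x (pr_th pr).
Proof. exact: ev2X. Qed.

Lemma ev_polyC_neq0 (c : {mpoly K[s]}) : c != 0 -> pr_ev pr c%:P != 0.
Proof. by rewrite pr_evC; apply/indep_neq0/(@pr_indep _ _ _ _ _ pr). Qed.

Lemma pr_size_gt1 : (1 < size P)%N.
Proof.
rewrite ltnNge; apply/negP => /size1_polyC e.
have c0 : P`_0 != 0 by have := pr_P0 pr; rewrite e polyC_eq0 coefC.
by have := ev_polyC_neq0 c0; rewrite -e pr_evP eqxx.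
Qed.

Definition specializes (L' : fieldType) (emb' : {rmorphism K -> L'}) (z : 'I_N -> L') :=
  forall G, mmap emb x G = 0 -> mmap emb' z G = 0.

Definition pr_lin i : {mpoly K[N]} := \sum_j pr_M pr i j *: 'X_j.

Lemma mmap_pr_lin (L' : fieldType) (emb' : {rmorphism K -> L'}) z i :
  mmap emb' z (pr_lin i) = lincomb emb' (pr_M pr) z i.
Proof.
rewrite raddf_sum; apply: eq_bigr => j _.
by rewrite /= mmapZ mmapX mmap1U.
Qed.

(* Substitutes back the polynomials in [x] for [y] and [theta]. *)
Definition pr_back : {rmorphism {poly {mpoly K[s]}} -> {mpoly K[N]}} :=
  ev2 (mmap (@mpolyC N K) pr_lin) (pr_th pr).

Lemma poly_mpoly_ext (n : nat) (T : comNzRingType)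
    (f g : {rmorphism {poly {mpoly K[n]}} -> T}) :
  (forall c, f (c%:MP)%:P = g (c%:MP)%:P) -> (forall i, f ('X_i)%:P = g ('X_i)%:P) ->
  f 'X = g 'X -> f =1 g.
Proof.
move=> hC hY hX p; rewrite -[p]coefK poly_def !rmorph_sum; apply: eq_bigr => i _.
rewrite -mul_polyC !rmorphM !rmorphXn hX; congr (_ * _).
exact: (mpoly_rmorph_ext (f := f \o polyC) (g := g \o polyC)).
Qed.

Lemma mmap_ev2 (n : nat) (l : 'I_n -> {mpoly K[N]}) (G : {mpoly K[N]})
    (L' : fieldType) (emb' : {rmorphism K -> L'}) z H :
  mmap emb' z (ev2 (mmap (@mpolyC N K) l) G H) =
  ev2 (mmap emb' (fun i => mmap emb' z (l i))) (mmap emb' z G) H.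
Proof.
apply: (poly_mpoly_ext (f := mmap emb' z \o ev2 (mmap (@mpolyC N K) l) G)) => [c|i|] /=.
- by rewrite ev2C ev2C /= !mmapC.
- by rewrite ev2C ev2C /= !mmapX !mmap1U.
- by rewrite !ev2X.
Qed.

Lemma mmap_pr_back (L' : fieldType) (emb' : {rmorphism K -> L'}) z H :
  mmap emb' z (pr_back H) =
  ev2 (mmap emb' (lincomb emb' (pr_M pr) z)) (mmap emb' z (pr_th pr)) H.
Proof.
rewrite mmap_ev2; congr (ev2 (mmap _ _) _ _).
by apply: boolp.funext => i; rewrite mmap_pr_lin.
Qed.

Section Spec.
Variables (L' : fieldType) (emb' : {rmorphism K -> L'}) (b : 'I_s -> L') (t : L').
Local Notation phi := (mmap emb' b).
Local Notation ev' := (ev2 (mmap emb' b) t).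
Hypotheses (lb : phi (lead_coef P) != 0) (qb : phi q != 0) (tP : ev' P = 0).

Lemma spec_zero H : pr_ev pr H = 0 -> ev' H = 0.
Proof.
move=> /pr_min [k [Q e]]; have := congr1 ev' e.
rewrite ev2Z rmorphM tP mulr0 => /eqP; rewrite mulf_eq0 rmorphXn expf_eq0.
by rewrite (negbTE lb) andbF => /eqP.
Qed.

(* The point of the locus of [x] obtained by setting [y := b] and [theta := t]. *)
Definition spec_point (i : 'I_N) : L' := ev' (pr_num 'X_i) / phi q.

(** [spec_point] is defined through the variables alone. The [G] for which some power of [q] clears
    the denominators compatibly on both sides contain the constants and the variables and are closed
    under sums and products, so they are all polynomials. *)
Lemma spec_exists G : exists k (H : {poly {mpoly K[s]}}),
  pr_ev pr H = mmap emb (pr_y pr) q ^+ k * mmap emb x G /\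
  ev' H = phi q ^+ k * mmap emb' spec_point G.
Proof.
pose Q (G : {mpoly K[N]}) := exists k (H : {poly {mpoly K[s]}}),
  pr_ev pr H = mmap emb (pr_y pr) q ^+ k * mmap emb x G /\
  ev' H = phi q ^+ k * mmap emb' spec_point G.
have QC c : Q c%:MP.
  by exists 0%N, ((c%:MP)%:P); rewrite pr_evC ev2C /= !mmapC !mul1r.
have QX i : Q 'X_i.
  exists 1%N, (pr_num 'X_i); rewrite pr_numP; split=> //.
  by rewrite mmapX mmap1U /spec_point mulrCA divff // mulr1.
have QM G1 G2 : Q G1 -> Q G2 -> Q (G1 * G2).
  move=> [k1 [H1 [e1 f1]]] [k2 [H2 [e2 f2]]]; exists (k1 + k2)%N, (H1 * H2).
  by rewrite !rmorphM !exprD e1 f1 e2 f2 mulrACA [phi q ^+ _ * _ * _]mulrACA.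
have QD G1 G2 : Q G1 -> Q G2 -> Q (G1 + G2).
  move=> [k1 [H1 [e1 f1]]] [k2 [H2 [e2 f2]]].
  exists (k1 + k2)%N, (q ^+ k2 *: H1 + q ^+ k1 *: H2).
  rewrite !rmorphD !pr_evZ !ev2Z e1 f1 e2 f2 !rmorphXn !exprD !mulrDr !mulrA.
  by split; congr (_ + _); rewrite [_ ^+ k2 * _]mulrC.
rewrite -/(Q G) [G]mpolyE; apply: big_ind => [||m _]; [exact: (QC 0)|exact: QD|].
rewrite -mul_mpolyC; apply: (QM); first exact: (QC).
rewrite mpolyXE_id; apply: big_ind => [||i _]; [exact: (QC 1)|exact: QM|].
by elim: (m i) => [|k IH]; [apply: (QC 1)|rewrite exprS; apply: QM].
Qed.

Lemma spec_eval H G : pr_ev pr H = mmap emb x G -> ev' H = mmap emb' spec_point G.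
Proof.
move=> e; have [k [H' [e1 e2]]] := spec_exists G.
have : pr_ev pr (q ^+ k *: H - H') = 0.
  by rewrite rmorphB pr_evZ e1 e rmorphXn subrr.
move/spec_zero => /eqP; rewrite rmorphB ev2Z e2 rmorphXn -mulrBr mulf_eq0.
by rewrite expf_eq0 (negbTE qb) andbF subr_eq0 => /eqP.
Qed.

Lemma spec_specializes : specializes emb' spec_point.
Proof. by move=> G e; rewrite -(spec_eval (H := 0)) ?rmorph0. Qed.

Lemma spec_lincomb : lincomb emb' (pr_M pr) spec_point =1 b.
Proof.
move=> i; rewrite -mmap_pr_lin -(spec_eval (H := ('X_i)%:P)).
  by rewrite ev2C /= mmapX mmap1U.
by rewrite mmap_pr_lin pr_evC mmapX mmap1U.
Qed.

Lemma spec_th : mmap emb' spec_point (pr_th pr) = t.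
Proof. by rewrite -(spec_eval (H := 'X)) ?ev2X ?pr_evX. Qed.

Lemma spec_num G : ev' (pr_num G) = phi q * mmap emb' spec_point G.
Proof.
have [k [H [e1 e2]]] := spec_exists G.
have : pr_ev pr (q ^+ k *: pr_num G - q *: H) = 0.
  by rewrite rmorphB !pr_evZ e1 pr_numP rmorphXn mulrCA subrr.
move/spec_zero => /eqP; rewrite rmorphB !ev2Z e2 rmorphXn mulrCA -mulrBr mulf_eq0.
by rewrite expf_eq0 (negbTE qb) andbF subr_eq0 => /eqP.
Qed.

End Spec.

(** The relation expressing [q x_i] by [y] and [theta] is inherited by [z]; where [q] is nonzero it
    determines [z] from its values of [y] and [theta]. *)
Lemma specializes_unique (L' : fieldType) (emb' : {rmorphism K -> L'}) (z : 'I_N -> L') :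
  specializes emb' z ->
  let b := lincomb emb' (pr_M pr) z in let t := mmap emb' z (pr_th pr) in
  mmap emb' b q != 0 ->
  ev2 (mmap emb' b) t P = 0 /\ z =1 spec_point emb' b t.
Proof.
move=> hz b t qb.
have back H : pr_ev pr H = mmap emb x (pr_back H) by rewrite mmap_pr_back.
split; first by rewrite -mmap_pr_back; apply: hz; rewrite -back pr_evP.
move=> i; apply: (mulIf qb); rewrite /spec_point divfK // -mmap_pr_back.
apply/eqP; rewrite -subr_eq0 mulrC; apply/eqP.
have e : mmap emb' b q = mmap emb' z (pr_back q%:P).
  by rewrite mmap_pr_back ev2C.
have e2 : z i = mmap emb' z 'X_i by rewrite mmapX mmap1U.
rewrite e e2 -rmorphM -rmorphB; apply: hz.
by rewrite rmorphB /= rmorphM /= -!back pr_evC pr_numP subrr.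
Qed.

End Generic.
Arguments pr_lin {K L emb N x} pr _.
End Specialization.

Module Fibre.
Import mpoly MpolyFacts WeightedDegree NoetherNormalization Fractions Presentation HilbertBound Specialization.

Section Fibre.
Variables (K : numClosedFieldType) (L : fieldType) (emb : {rmorphism K -> L}).
Variables (N : nat) (x : 'I_N -> L) (pr : presentation emb x).
Local Notation s := (pr_s pr).
Local Notation P := (pr_P pr).
Local Notation q := (pr_q pr).

Definition in_locus (z : 'I_N -> K) :=
  forall G : {mpoly K[N]}, mmap emb x G = 0 -> G.@[z] = 0.

Section At.
Variables (a : 'I_s -> K).
Hypotheses (la : (lead_coef P).@[a] != 0) (qa : q.@[a] != 0).
Let Pa := map_poly (meval a) P.

Lemma size_Pa : size Pa = size P.
Proof. by rewrite size_poly_eq. Qed.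

(** [P] at [a] has a root [t] in the algebraically closed [K]. At [(a, t)] the Bezout identity
    leaves a nonzero constant, so the numerator of [G], and with it [G], is nonzero at the point
    above. *)
Lemma density_at G U V c : c.@[a] != 0 -> U * pr_num pr G + V * P = c%:P ->
  exists z, in_locus z /\ G.@[z] != 0.
Proof.
move=> ca e.
have [t /rootP tP] : exists t, root Pa t.
  by apply/closed_rootP; rewrite size_Pa; have := pr_size_gt1 pr; case: (size P) => [|[]].
exists (spec_point idfun a t).
have tP' : ev2 (mmap idfun a) t P = 0 by [].
split; first exact: (spec_specializes la qa tP').
have e1 := spec_num la qa tP' G.
have := congr1 (ev2 (mmap idfun a) t) e.
rewrite rmorphD !rmorphM tP' mulr0 addr0 e1 ev2C => e2.
apply/eqP => G0; move: ca; rewrite /meval -e2.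
by rewrite -[mmap _ _ G]/(G.@[_]) G0 !mulr0 eqxx.
Qed.

(** The Bezout identity makes [P] at [a] separable, so it has as many roots as its degree; each root
    is the value of [theta] at exactly one point of the fibre. *)
Lemma fibre_at U V c : c.@[a] != 0 -> U * P^`() + V * P = c%:P ->
  exists ts : seq K, [/\ uniq ts, size ts = pr_e pr,
    forall t, t \in ts -> [/\ in_locus (spec_point idfun a t),
        lincomb idfun (pr_M pr) (spec_point idfun a t) =1 a &
        (pr_th pr).@[spec_point idfun a t] = t] &
    forall z, in_locus z -> lincomb idfun (pr_M pr) z =1 a ->
      (pr_th pr).@[z] \in ts /\ z =1 spec_point idfun a (pr_th pr).@[z]].
Proof.
move=> ca e.
have Pa0 : Pa != 0 by rewrite -size_poly_eq0 size_Pa size_poly_eq0 pr_P0.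
have [ts tsE] := closed_field_poly_normal Pa.
have sep : separable_poly Pa.
  rewrite separable_poly.unlock coprimep_sym; apply/Bezout_coprimepP.
  exists (map_poly (meval a) U, map_poly (meval a) V) => /=.
  rewrite /Pa deriv_map -!rmorphM -rmorphD e /= map_polyC /=.
  by rewrite polyC_eqp1.
have rootE t : root Pa t = (t \in ts).
  by rewrite tsE rootZ ?root_prod_XsubC // lead_coef_eq0.
exists ts; split.
- have lP : lead_coef Pa != 0 by rewrite lead_coef_eq0.
  by rewrite -separable_prod_XsubC -(eqp_separable (eqp_scale _ lP)) -tsE.
- by rewrite /pr_e -size_Pa tsE size_scale ?lead_coef_eq0 // size_prod_XsubC.
- move=> t; rewrite -rootE => /rootP tP.
  have tP' : ev2 (mmap idfun a) t P = 0 by [].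
  by split; [apply: (spec_specializes la qa tP')|apply: (spec_lincomb la qa tP')|
    apply: (spec_th la qa tP')].
move=> z hz za.
have {}za : lincomb idfun (pr_M pr) z = a by apply: boolp.funext.
have := specializes_unique (pr := pr) (emb' := idfun) hz.
rewrite /= za => /(_ qa) [h1 h2]; split=> //.
by rewrite -rootE; apply/rootP.
Qed.

End At.

(** A Nullstellensatz for the locus of [x]: the point [a] only has to avoid the zeros of the leading
    coefficient, of [q] and of the Bezout constant. *)
Theorem density G : mmap emb x G != 0 -> exists z, in_locus z /\ G.@[z] != 0.
Proof.
move=> G0; have : pr_ev pr (pr_num pr G) <> 0.
  apply/eqP; rewrite pr_numP mulf_neq0 // -pr_evC; apply: ev_polyC_neq0.
  exact: pr_q0.
move=> /pr_coprime [U [V [c [c0 e]]]].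
have : lead_coef P * q * c != 0.
  by rewrite !mulf_neq0 ?pr_q0 // lead_coef_eq0 pr_P0.
case/mpoly_nonvanishing => a; rewrite !mevalM !mulf_eq0 !negb_or.
by move=> /andP[/andP[la qa] ca]; apply: (density_at la qa ca e).
Qed.

Theorem fibre : exists a : 'I_s -> K,
  exists (ts : seq K) (pt : K -> 'I_N -> K), [/\ uniq ts, size ts = pr_e pr,
    forall t, t \in ts -> [/\ in_locus (pt t), lincomb idfun (pr_M pr) (pt t) =1 a &
       (pr_th pr).@[pt t] = t] &
    forall z, in_locus z -> lincomb idfun (pr_M pr) z =1 a ->
      (pr_th pr).@[z] \in ts /\ z =1 pt (pr_th pr).@[z]].
Proof.
(* In characteristic zero the derivative is nonzero, and it is shorter than [P]; minimality forbids
   it to vanish at [theta]. *)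
have dP : pr_ev pr P^`() <> 0.
  move/pr_small => /(_ (lt_size_deriv (pr_P0 pr))) /(congr1 (fun p : {poly _} => p`_(size P).-2)).
  have := pr_size_gt1 pr; have := pr_P0 pr; rewrite -lead_coef_eq0 lead_coefE.
  rewrite coef_deriv coef0; case: (size P) => [|[|n]] //= h _ /eqP.
  apply/negP; apply: contra h => /eqP h; apply/eqP/mpolyP => m.
  have /eqP := congr1 (mcoeff m) h; rewrite mcoeffMn mcoeff0 mulrn_eq0 /=.
  by move/eqP.
have [U [V [c [c0 e]]]] := pr_coprime dP.
have : lead_coef P * q * c != 0.
  by rewrite !mulf_neq0 ?pr_q0 // lead_coef_eq0 pr_P0.
case/mpoly_nonvanishing => a; rewrite !mevalM !mulf_eq0 !negb_or.
move=> /andP[/andP[la qa] ca]; have [ts h] := fibre_at la qa ca e.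
by exists a, ts, (spec_point idfun a).
Qed.

End Fibre.
End Fibre.

(** * Generic points of prime ideals *)

Module GenericPoint.
Import mpoly MpolyFacts.
Local Open Scope quotient_scope.

(* Inverses in a domain are chosen classically, which makes it an [idomainType]. *)
Lemma domain_to_field (D : comNzRingType) :
  (forall a b : D, a * b = 0 -> (a == 0) || (b == 0)) ->
  exists (L : fieldType) (f : {rmorphism D -> L}), injective f.
Proof.
move=> int.
pose u (a : D) : bool := boolp.asbool (exists b, b * a = 1).
pose inv (a : D) : D := if boolp.pselect (exists b, b * a = 1) is left h
   then sval (boolp.cid h) else a.
have h1 : {in u, left_inverse 1 inv *%R}.
  move=> a /boolp.asboolP h; rewrite /inv; case: boolp.pselect => // h'.
  by case: (boolp.cid h').
have h2 : forall a b, b * a = 1 -> u a.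
  by move=> a b e; apply/boolp.asboolP; exists b.
have h3 : {in [predC u], inv =1 id}.
  move=> a /negP h; rewrite /inv; case: boolp.pselect => // h'.
  by case: h; apply/boolp.asboolP.
pose m1 := GRing.ComNzRing_hasMulInverse.Build D h1 h2 h3.
pose U : comUnitRingType := HB.pack (GRing.ComNzRing.sort D) m1.
pose m2 := GRing.ComUnitRing_isIntegral.Build U int.
pose I : idomainType := HB.pack (GRing.ComUnitRing.sort U) m2.
pose f : D -> {fraction I} := @FracField.tofrac I.
pose m3 := GRing.isZmodMorphism.Build D {fraction I} f (@tofrac_is_zmod_morphism I).
pose m4 := GRing.isMonoidMorphism.Build D {fraction I} f (@tofrac_is_monoid_morphism I).
pose F : {rmorphism D -> {fraction I}} := HB.pack f m3 m4.
exists {fraction I}, F.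
by move=> a b /eqP; rewrite tofrac_eq => /eqP.
Qed.

Lemma prime_ideal_kernel (R : comNzRingType) (I : R -> Prop) :
  I 0 -> ~ I 1 -> (forall a u v, I u -> I v -> I (a * u + v)) ->
  (forall u v, I (u * v) -> I u \/ I v) ->
  exists (L : fieldType) (f : {rmorphism R -> L}), forall r, f r = 0 <-> I r.
Proof.
move=> I0 I1 ID IP.
pose S (r : R) : bool := boolp.asbool (I r).
have h1 : idealr_closed S.
  split; [exact/boolp.asboolP|by apply/boolp.asboolP|].
  by move=> a u v /boolp.asboolP hu /boolp.asboolP hv; apply/boolp.asboolP/ID.
have h2 : prime_idealr_closed S.
  move=> u v /boolp.asboolP /IP [h|h]; apply/orP; [left|right]; exact/boolp.asboolP.
pose m1 := isIdealr.Build R S h1.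
pose m2 := isPrimeIdealrClosed.Build R S h2.
pose J : prime_idealr R := HB.pack S m1 m2.
have [L [f inj]] := domain_to_field (@Quotient.rquot_IdomainAxiom R J).
pose g : {rmorphism R -> L} := f \o \pi_({ideal_quot J}).
exists L, g => r; rewrite /g /=.
have e : (f (\pi_({ideal_quot J}) r) = 0) <-> \pi_({ideal_quot J}) r = 0.
  split=> [h|->]; last by rewrite rmorph0.
  by apply: inj; rewrite h rmorph0.
rewrite e; have -> : (\pi_({ideal_quot J}) r = 0) <-> (r \in J).
  rewrite -[0](rmorph0 \pi_({ideal_quot J})).
  by rewrite -[X in X \in J]subr0 Quotient.idealrBE; split=> [/eqP|/eqP].
by split=> /boolp.asboolP.
Qed.

Theorem exists_generic_point (K : fieldType) (N : nat) (I : {mpoly K[N]} -> Prop) :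
  I 0 -> ~ I 1 -> (forall a u v, I u -> I v -> I (a * u + v)) ->
  (forall u v, I (u * v) -> I u \/ I v) ->
  exists (L : fieldType) (emb : {rmorphism K -> L}) (x : 'I_N -> L),
    forall G, mmap emb x G = 0 <-> I G.
Proof.
move=> I0 I1 ID IP; have [L [f hf]] := prime_ideal_kernel I0 I1 ID IP.
exists L, (f \o @mpolyC N K : {rmorphism K -> L}), (fun i => f 'X_i) => G.
rewrite -hf; suff -> : mmap (f \o @mpolyC N K) (fun i => f 'X_i) G = f G by [].
apply: (mpoly_rmorph_ext (f := mmap (f \o @mpolyC N K) (fun i => f 'X_i)) (g := f)) => [c|i] /=.
  by rewrite mmapC.
by rewrite mmapX mmap1U.
Qed.

End GenericPoint.

(** * Dimension and degree *)

Module Dimension.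
Import mpoly MpolyFacts WeightedDegree NoetherNormalization Fractions Presentation HilbertBound Specialization Fibre.

Lemma exists_root_extension (F : fieldType) (p : {poly F}) : (1 < size p)%N ->
  exists (L : fieldType) (iota : {rmorphism F -> L}) (t : L), (map_poly iota p).[t] = 0.
Proof.
have [n] := ubnP (size p); elim: n p => // n IH p; rewrite ltnS => sp p1.
have p0 : p != 0 by rewrite -size_poly_eq0; case: (size p) p1.
case: (classic (irreducible_poly p)) => [/irredp_FAdjoin [L _ [t /rootP pt _]]|irr].
  by exists L, (in_alg L), t.
have [d [d1 dp nd]] : exists d : {poly F}, [/\ size d != 1%N, d %| p & ~~ (d %= p)].
  apply: NNPP => H; apply: irr; split=> // d d1 dp.
  by apply: contra_notT H => nd; exists d.
have sd : (size d <= size p)%N by apply: dvdp_leq.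
have sd' : (size d < size p)%N.
  by rewrite ltn_neqAle sd andbT; apply: contra nd; rewrite -dvdp_size_eqp.
have d1' : (1 < size d)%N.
  have d0 : d != 0 by apply: contraNneq p0 => d0; rewrite d0 dvd0p in dp.
  by rewrite ltn_neqAle eq_sym d1 size_poly_gt0.
have [L [iota [t et]]] := IH d (leq_trans sd' sp) d1'.
exists L, iota, t; have /dvdpP [r ->] := dp.
by rewrite rmorphM hornerM et mulr0.
Qed.

Section Trdeg.
Variables (K : numFieldType) (L : fieldType) (emb : {rmorphism K -> L}).
Variables (N : nat) (x : 'I_N -> L) (pr : presentation emb x).

(* The [(n+1)^r] monomials in [u] with exponents at most [n] would outnumber the
   HilbertBound function bound, which is of order [n^s]. *)
Lemma trdeg_le r (u : 'I_r -> {mpoly K[N]}) :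
  alg_indep emb (fun i => mmap emb x (u i)) -> (r <= pr_s pr)%N.
Proof.
move=> ind; rewrite leqNgt; apply/negP => sr.
pose k := (\max_i msize (u i))%N.
have uk i : (msize (u i) <= k.+1)%N.
  by apply: leqW; apply: (leq_bigmax (F := fun i => msize (u i))).
set s := pr_s pr in sr; set e := pr_e pr.
(* This choice gives [e * (r * n * k + 1) ^ s <= n * (n + 1) ^ s < (n + 1) ^ (s + 1)], and
   [s + 1 <= r]. *)
pose n := (e * (r * k + 1) ^ s)%N.
pose T := {ffun 'I_r -> 'I_n.+1}.
pose mon (f : T) : 'X_{1..r} := [multinom (f i : nat) | i < r].
have mon_inj : injective mon.
  move=> f1 f2 e12; apply/ffunP => i; apply/val_inj.
  by have := congr1 (fun m : 'X_{1..r} => m i) e12; rewrite !mnmE.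
pose g (j : 'I_#|{: T}|) := \prod_i u i ^+ mon (enum_val j) i.
have gs j : (msize (g j) <= (r * n * k).+1)%N.
  have pw i a : (msize (u i ^+ a) <= (a * k).+1)%N.
    elim: a => [|a IH]; first by rewrite expr0 msize1.
    have [->|p0] := eqVneq (u i) 0; first by rewrite expr0n msize0.
    rewrite exprS msizeM ?expf_neq0 //; move: (uk i) IH.
    by move: (msize (u i)) (msize (u i ^+ a)) => v w; rewrite mulSn; lia.
  rewrite /g -mulnA -[X in (X * _)%N](card_ord r) -sum_nat_const.
  apply: (big_ind2 (fun p d => msize p <= d.+1)%N) => [|p a q b hp hq|i _].
  - by rewrite msize1.
  - have [->|p0] := eqVneq p 0; first by rewrite mul0r msize0.
    have [->|q0] := eqVneq q 0; first by rewrite mulr0 msize0.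
    by rewrite msizeM //; move: hp hq; move: (msize p) (msize q) => v w; lia.
  apply: leq_trans (pw _ _) _; rewrite ltnS leq_mul2r mnmE -ltnS ltn_ord orbT //.
have cardT : (e * (r * n * k).+1 ^ s < #|{: T}|)%N.
  rewrite card_ffun !card_ord.
  apply: (@leq_ltn_trans (e * ((r * k + 1) * n.+1) ^ s)%N).
    have h : (r * n * k < (r * k + 1) * n.+1)%N.
      by rewrite mulnAC mulnS mulnDl mul1n; lia.
    rewrite leq_mul2l; apply/orP; right.
    by elim: (s) => // s1 IH1; rewrite !expnS leq_mul.
  rewrite expnMn mulnA -/n; apply: (@leq_trans (n.+1 ^ s.+1)).
    by rewrite expnS ltn_pmul2r // expn_gt0.
  by rewrite leq_pexp2l.
have [c [c0 ec]] := hilbert_bound gs cardT.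
have : \sum_j c 0 j *: 'X_[mon (enum_val j)] = 0 :> {mpoly K[r]}.
  apply: ind; rewrite -[RHS]ec !raddf_sum; apply: eq_bigr => j _ /=.
  by rewrite !mmapZ mmapX /mmap1 /g rmorph_prod; congr (_ * _); apply: eq_bigr => i _; rewrite rmorphXn.
move=> c00; case/eqP: c0; apply/rowP => j.
have := congr1 (mcoeff (mon (enum_val j))) c00.
rewrite raddf_sum mcoeff0 (bigD1 j) //= mcoeffZ mcoeffX eqxx mulr1 big1 ?addr0 => [->|j' ne].
  by rewrite mxE.
rewrite mcoeffZ mcoeffX (inj_eq mon_inj) (inj_eq enum_val_inj) (negbTE ne) mulr0 //.
Qed.

End Trdeg.

Section Dim.
Variables (K : numFieldType) (L : fieldType) (emb : {rmorphism K -> L}).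
Variables (N : nat) (x : 'I_N -> L) (pr : presentation emb x).

(* [G0] together with the coordinates [y'] of [x'] are independent at [x]: in a
   relation, the lowest power of [G0] can be cancelled, and the rest specializes
   to a relation between the [y'] alone. *)
Lemma dim_strict (L' : fieldType) (emb' : {rmorphism K -> L'}) (x' : 'I_N -> L')
    (pr' : presentation emb' x') (G0 : {mpoly K[N]}) :
  specializes emb x emb' x' -> mmap emb x G0 != 0 -> mmap emb' x' G0 = 0 ->
  (pr_s pr' < pr_s pr)%N.
Proof.
move=> sp G00 G0'; set s' := pr_s pr'.
pose l i := pr_lin pr' i.
pose ev := ev2 (mmap emb (fun i => mmap emb x (l i))) (mmap emb x G0).
have claim (p : {poly {mpoly K[s']}}) : ev p = 0 -> p = 0.
  elim/poly_ind: p => // p c IH e.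
  have : mmap emb x (ev2 (mmap (@mpolyC N K) l) G0 (p * 'X + c%:P)) = 0.
    by rewrite mmap_ev2.
  move/sp; rewrite mmap_ev2 G0' rmorphD rmorphM ev2X mulr0 add0r ev2C => c0.
  have {}c0 : c = 0.
    apply: (@pr_indep _ _ _ _ _ pr'); rewrite -[RHS]c0.
    congr (mmap _ _ _); apply: boolp.funext => i.
    by rewrite mmap_pr_lin.
  move: e; rewrite c0 addr0 rmorphM /ev ev2X => /eqP.
  by rewrite mulf_eq0 (negbTE G00) orbF => /eqP /IH ->; rewrite mul0r.
pose u (i : 'I_s'.+1) := if unlift ord0 i is Some j then l j else G0.
apply: (trdeg_le pr (u := u)) => f fu.
pose Phi : {rmorphism {mpoly K[s'.+1]} -> {poly {mpoly K[s']}}} :=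
  mmap (polyC \o @mpolyC s' K)
    (fun i => if unlift ord0 i is Some j then ('X_j)%:P else 'X).
pose Psi : {rmorphism {poly {mpoly K[s']}} -> {mpoly K[s'.+1]}} :=
  ev2 (mmap (@mpolyC s'.+1 K) (fun j => 'X_(lift ord0 j))) 'X_ord0.
have PhiK : Psi (Phi f) = f.
  apply: (mpoly_rmorph_ext (f := Psi \o Phi) (g := idfun)) => [c|i] /=.
    by rewrite /Phi /= mmapC /= /Psi ev2C /= mmapC.
  rewrite /Phi /= mmapX mmap1U /Psi; case: unliftP => [j|] ->.
    by rewrite ev2C /= mmapX mmap1U.
  by rewrite ev2X.
rewrite -PhiK [Phi f]claim ?rmorph0 // -[RHS]fu.
apply: (mpoly_rmorph_ext (f := ev \o Phi) (g := mmap emb (fun i => mmap emb x (u i)))) => [c|i] /=.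
  by rewrite /Phi /= !mmapC /ev ev2C /= mmapC.
rewrite /Phi /= !mmapX !mmap1U /u /ev; case: unliftP => [j|] _.
  by rewrite ev2C /= mmapX mmap1U.
by rewrite ev2X.
Qed.

(* Specialize one coordinate of [y] to a constant and keep the others generic. *)
Lemma descent : (0 < pr_s pr)%N ->
  exists (L' : fieldType) (emb' : {rmorphism K -> L'}) (x' : 'I_N -> L'),
  [/\ specializes emb x emb' x',
      exists G0, mmap emb x G0 != 0 /\ mmap emb' x' G0 = 0 &
      forall pr' : presentation emb' x', (pr_s pr <= (pr_s pr').+1)%N].
Proof.
move=> s0; pose i0 := Ordinal s0.
set s := pr_s pr in s0 i0 *.
have lq0 : lead_coef (pr_P pr) * pr_q pr != 0.
  by rewrite mulf_neq0 ?pr_q0 // lead_coef_eq0 pr_P0.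
have [a ha] := mpoly_nonvanishing lq0.
pose A := {mpoly K[s]}.
pose b0 (i : 'I_s) : A := if i == i0 then (a i0)%:MP else 'X_i.
pose sub : {rmorphism A -> A} := mmap (@mpolyC s K) b0.
(* [f] and its partial specialization agree at [a], so the leading coefficient and [q] stay nonzero
   when a single coordinate is set. *)
have sub_neq0 (f : A) : f.@[a] != 0 -> sub f != 0.
  apply: contraNneq => e; suff <- : (sub f).@[a] = f.@[a] by rewrite e rmorph0.
  apply: (mpoly_rmorph_ext (f := meval a \o sub) (g := meval a)) => [c|i] /=.
    by rewrite /sub /= mmapC !mevalC.
  rewrite /sub /= mmapX mmap1U /b0; case: eqP => [->|_] //.
  by rewrite mevalC mevalXU.
pose F := {fraction A}.
pose tf : {rmorphism A -> F} := @FracField.tofrac A.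
pose P1 : {poly F} := map_poly (tf \o sub) (pr_P pr).
move: ha; rewrite mevalM mulf_eq0 negb_or => /andP[la qa].
have P1s : (1 < size P1)%N.
  rewrite /P1 size_poly_eq; first exact: pr_size_gt1.
  by rewrite /= tofrac_eq0 sub_neq0.
have [L' [iota [t et]]] := exists_root_extension P1s.
pose emb' : {rmorphism K -> L'} := iota \o tf \o @mpolyC s K.
pose b i : L' := iota (tf (b0 i)).
have bE f : mmap emb' b f = iota (tf (sub f)).
  apply: (mpoly_rmorph_ext (f := mmap emb' b) (g := iota \o tf \o sub)) => [c|i] /=.
    by rewrite /sub /= !mmapC.
  by rewrite /sub /= !mmapX !mmap1U.
have lb : mmap emb' b (lead_coef (pr_P pr)) != 0.
  by rewrite bE fmorph_eq0 tofrac_eq0 sub_neq0.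
have qb : mmap emb' b (pr_q pr) != 0.
  by rewrite bE fmorph_eq0 tofrac_eq0 sub_neq0.
have tP : ev2 (mmap emb' b) t (pr_P pr) = 0.
  rewrite -[RHS]et /P1 ev2E -map_poly_comp; congr (_.[t]).
  by apply: eq_map_poly => f; exact: bE.
exists L', emb', (spec_point emb' b t); split.
- exact: spec_specializes.
- exists (pr_lin pr i0 - (a i0)%:MP); rewrite !rmorphB /= !mmapC !mmap_pr_lin; split.
    have h : 'X_i0 - (a i0)%:MP != 0 :> A.
      apply/eqP => /(congr1 (mcoeff U_(i0)%MM)).
      rewrite mcoeffB mcoeffXU mcoeffC mnm1_eq0 mulr0 subr0 eqxx mcoeff0 => /eqP.
      by rewrite oner_eq0.
    have := indep_neq0 (@pr_indep _ _ _ _ _ pr) h.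
    by rewrite rmorphB /= mmapX mmap1U mmapC.
  by rewrite spec_lincomb // /b /b0 eqxx subrr.
(* The [s - 1] other forms remain independent at the new point, which bounds its transcendence
   degree from below. *)
move=> pr'; rewrite -(prednK s0) ltnS.
apply: (trdeg_le pr' (u := fun j => pr_lin pr (lift i0 j))).
move=> f; have -> : (fun j => mmap emb' (spec_point emb' b t) (pr_lin pr (lift i0 j)))
   = fun j => iota (tf 'X_(lift i0 j)).
  apply: boolp.funext => j; rewrite mmap_pr_lin spec_lincomb // /b /b0.
pose up : {rmorphism {mpoly K[s.-1]} -> A} := mmap (@mpolyC s K) (fun j => 'X_(lift i0 j)).
pose down : {rmorphism A -> {mpoly K[s.-1]}} :=
  mmap (@mpolyC s.-1 K) (fun i => if unlift i0 i is Some j then 'X_j else 0).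
have upK : down (up f) = f.
  apply: (mpoly_rmorph_ext (f := down \o up) (g := idfun)) => [c|i] /=.
    by rewrite /up /down /= !mmapC.
  by rewrite /up /down /= !mmapX !mmap1U mmapX mmap1U liftK.
have -> : mmap emb' (fun j => iota (tf 'X_(lift i0 j))) f = iota (tf (up f)).
  apply: (mpoly_rmorph_ext (f := mmap emb' _) (g := iota \o tf \o up)) => [c|i] /=.
    by rewrite /up /= !mmapC.
  by rewrite /up /= !mmapX !mmap1U.
move/eqP; rewrite fmorph_eq0 tofrac_eq0 => /eqP e.
by rewrite -upK e rmorph0.
Qed.

End Dim.
End Dimension.

(** * Irreducible sets, dimension, components and linear sections through generic points *)

Module AffineGeometry.
Import mpoly MpolyFacts WeightedDegree NoetherNormalization Fractions Presentation HilbertBound Specialization Fibre.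
Import GenericPoint Dimension.
From mathcomp Require Import classical_sets.
Local Open Scope classical_set_scope.

Section AffineGeometry.
Variables (K : numClosedFieldType) (N : nat) (X : eqType).
Variables (co : X -> 'I_N -> K) (oc : ('I_N -> K) -> X).
Hypotheses (ocK : forall z, co (oc z) = z) (coK : forall A, oc (co A) = A).
Implicit Types (Z S : set X) (G : {mpoly K[N]}).

(** The notions of the theorem over an abstract [X] in bijection with [K^N]; with [End_ R n] as [X]
    they unfold to the original ones, so that results transfer by conversion. *)
Definition zlocus (P : set {mpoly K[N]}) : set X :=
  [set A | forall q, P q -> meval (co A) q = 0].

Definition zclosed S := exists P : set {mpoly K[N]}, S = zlocus P.

Definition zirr Z := [/\ zclosed Z, Z !=set0 &
  forall Z1 Z2, zclosed Z1 -> zclosed Z2 -> Z = Z1 `|` Z2 -> Z = Z1 \/ Z = Z2].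

Definition zchain S k := exists Z : nat -> set X,
    [/\ forall i, (i <= k)%N -> zirr (Z i),
        forall i, (i <= k)%N -> Z i `<=` S &
        forall i, (i < k)%N -> Z i `<` Z i.+1].

Definition zdim S d := zchain S d /\ ~ zchain S d.+1.

Definition zcomponent S Z := [/\ zirr Z, Z `<=` S &
  forall Z', zirr Z' -> Z `<=` Z' -> Z' `<=` S -> Z' = Z].

Definition vanishing Z G := forall A, Z A -> meval (co A) G = 0.

(* [Z] is the closure of a generic point [x] of transcendence degree [d] such that
   [K(x)] has degree [e] over a transcendence basis of linear forms in [x]. *)
Definition gdata Z d e := exists (L : fieldType) (emb : {rmorphism K -> L})
    (x : 'I_N -> L) (pr : presentation emb x),
  [/\ Z = [set A | in_locus emb x (co A)],
      forall G, vanishing Z G -> mmap emb x G = 0,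
      d = pr_s pr & e = pr_e pr].

Lemma zclosedE Z : zclosed Z -> Z = zlocus (vanishing Z).
Proof.
case=> P ->; apply/seteqP; split=> A hA q hq; first exact: hq.
by apply: hA => B; apply.
Qed.

Lemma zclosedI Z G : zclosed Z -> zclosed (Z `&` [set A | meval (co A) G = 0]).
Proof.
case=> P ->; exists (P `|` [set G]); apply/seteqP; split=> A.
  by move=> [h1 h2] q [/h1|->].
by move=> h; split=> [q hq|]; apply: h; [left|right].
Qed.

(** The vanishing ideal is prime: if [u * v] vanishes on [Z], the zeros of [u] and those of [v]
    cover [Z], and irreducibility selects one of them. *)
Lemma zirr_gdata Z : zirr Z -> exists d e, gdata Z d e.
Proof.
case=> cZ [A0 ZA0] hZ.
have [||a u v hu hv A ZA|u v huv|L [emb [x hx]]] := @exists_generic_point K N (vanishing Z).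
- by move=> A _; rewrite meval0.
- by move=> /(_ A0 ZA0) /eqP; rewrite meval1 oner_eq0.
- by rewrite mevalD mevalM hu // hv // mulr0 addr0.
- have := hZ _ _ (zclosedI u cZ) (zclosedI v cZ).
  case=> [|e|e].
  + apply/seteqP; split=> [A ZA|A [[]|[]] //].
    have /eqP := huv A ZA; rewrite mevalM mulf_eq0 => /orP[/eqP h|/eqP h].
      by left.
    by right.
  + by left => A; rewrite e => -[].
  + by right => A; rewrite e => -[].
have [pr] := exists_presentation emb x.
exists (pr_s pr), (pr_e pr), L, emb, x, pr; split=> //; last by move=> G /hx.
rewrite {1}(zclosedE cZ); apply/seteqP; split=> A h q /hx; exact: h.
Qed.

Lemma generic_vanishing (L : fieldType) (emb : {rmorphism K -> L}) (x : 'I_N -> L) G :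
  vanishing [set A | in_locus emb x (co A)] G -> mmap emb x G = 0.
Proof.
move=> h; apply/eqP; apply: contraT => G0.
have [pr] := exists_presentation emb x.
have [z [hz]] := density pr G0.
have := h (oc z); rewrite /= ocK => -> //.
by rewrite eqxx.
Qed.

Lemma generic_irr (L : fieldType) (emb : {rmorphism K -> L}) (x : 'I_N -> L) :
  zirr [set A | in_locus emb x (co A)].
Proof.
set Z := [set A | _]; have vZ := @generic_vanishing _ emb x.
split.
- exists [set G | mmap emb x G = 0]; apply/seteqP; split=> A h q; exact: h.
- have [pr] := exists_presentation emb x.
  have [|z [hz _]] := density (G := 1) pr; first by rewrite rmorph1 oner_eq0.
  by exists (oc z); rewrite /Z /= ocK.
move=> Z1 Z2 c1 c2 e; apply: NNPP => H.
have ex Zi : zclosed Zi -> Z <> Zi -> Zi `<=` Z ->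
    exists G, vanishing Zi G /\ mmap emb x G != 0.
  move=> ci ne sub; apply: NNPP => H'; apply: ne; apply/seteqP; split=> // A ZA.
  rewrite (zclosedE ci) => q hq; apply: ZA; apply: NNPP => /eqP q0.
  by apply: H'; exists q.
have [|G1 [h1 n1]] := ex Z1 c1 (fun e1 => H (or_introl e1)).
  by rewrite e => A; left.
have [|G2 [h2 n2]] := ex Z2 c2 (fun e1 => H (or_intror e1)).
  by rewrite e => A; right.
have /eqP : mmap emb x (G1 * G2) = 0.
  apply: vZ; rewrite -/Z e => A [/h1|/h2] h; rewrite mevalM h ?mul0r ?mulr0 //.
by rewrite rmorphM mulf_eq0 (negbTE n1) (negbTE n2).
Qed.

Lemma generic_gdata (L : fieldType) (emb : {rmorphism K -> L}) (x : 'I_N -> L)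
    (pr : presentation emb x) :
  gdata [set A | in_locus emb x (co A)] (pr_s pr) (pr_e pr).
Proof. by exists L, emb, x, pr; split=> // G; apply: generic_vanishing. Qed.

Lemma gdata_irr Z d e : gdata Z d e -> zirr Z.
Proof. by move=> [L [emb [x [pr [-> _ _ _]]]]]; apply: generic_irr. Qed.

Lemma gdata_strict Z Z' d e d' e' :
  gdata Z d e -> gdata Z' d' e' -> Z' `<` Z -> (d' < d)%N.
Proof.
move=> [L [emb [x [pr [eZ vZ -> _]]]]] [L' [emb' [x' [pr' [eZ' vZ' -> _]]]]].
move=> [sub nsub].
have [G0 [h1 h2]] : exists G0, mmap emb x G0 != 0 /\ mmap emb' x' G0 = 0.
  apply: NNPP => H; apply: nsub => A ZA; rewrite eZ' => G hG.
  rewrite eZ in ZA; apply: ZA; apply: NNPP => /eqP G0; apply: H.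
  by exists G.
apply: (dim_strict pr pr' _ h1 h2) => G hG.
by apply: vZ' => A /sub; rewrite eZ; apply.
Qed.

Lemma gdata_descent Z d e : gdata Z d e -> (0 < d)%N ->
  exists Z' d' e', [/\ gdata Z' d' e', Z' `<` Z & (d <= d'.+1)%N].
Proof.
move=> [L [emb [x [pr [eZ vZ -> _]]]]] d0.
have [L' [emb' [x' [sp [G0 [h1 h2]] hd]]]] := descent d0.
have [pr'] := exists_presentation emb' x'.
exists [set A | in_locus emb' x' (co A)], (pr_s pr'), (pr_e pr').
split=> //; first exact: generic_gdata.
split; first by move=> A hA; rewrite eZ => G /sp; apply: hA.
move=> sub; case/eqP: h1; apply: vZ => A /sub; exact.
Qed.

Lemma zchainW S k j : (j <= k)%N -> zchain S k -> zchain S j.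
Proof.
move=> jk [Z [h1 h2 h3]]; exists Z; split=> i hi.
- exact/h1/(leq_trans hi).
- exact/h2/(leq_trans hi).
- exact/h3/(leq_trans hi).
Qed.

(** The chain is built downwards from [Z]: [gdata_descent] loses at most one dimension and
    [gdata_strict] at least one, so exactly [d] steps lead to dimension 0. *)
Lemma gdata_chain S Z d e : gdata Z d e -> Z `<=` S -> zchain S d.
Proof.
move=> gZ ZS.
suff [Zs [h1 h2 h3]] : exists Zs : nat -> set X, [/\ forall i, (i <= d)%N -> zirr (Zs i),
    Zs d `<=` Z & forall i, (i < d)%N -> Zs i `<` Zs i.+1].
  exists Zs; split=> // i id; apply: subset_trans ZS; apply: subset_trans h2.
  have : (i <= d)%N by [].
  rewrite leq_eqVlt => /orP[/eqP->//|{}id].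
  have H j : (i + j <= d)%N -> Zs i `<=` Zs (i + j)%N.
    elim: j => [|j IH] hj; first by rewrite addn0.
    apply: subset_trans (IH _) _; first by apply: leq_trans hj; rewrite leq_add2l.
    by rewrite addnS; apply: (properW (h3 _ _)); rewrite -addnS.
  by have := H (d - i)%N; rewrite subnKC ?(ltnW id) //; apply.
clear ZS S; have [n] := ubnP d.
elim: n d e Z gZ => // n IH d e Z gZ; rewrite ltnS => dn.
case: (posnP d) => [d0|d0].
  exists (fun=> Z); split=> [i _| |i]; [exact: gdata_irr gZ|by []|by rewrite d0].
have [Z' [d' [e' [gZ' ZZ' dd']]]] := gdata_descent gZ d0.
have d'd : d'.+1 = d by apply/eqP; rewrite eqn_leq dd' (gdata_strict gZ gZ').
have [|Zs [h1 h2 h3]] := IH d' e' Z' gZ'; first by rewrite -ltnS d'd.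
exists (fun i => if (i <= d')%N then Zs i else Z); split.
- by move=> i _; case: ifP => [/h1//|_]; exact: gdata_irr gZ.
- by rewrite leqNgt -d'd ltnSn.
move=> i; rewrite -d'd ltnS => id; rewrite id.
case: ltnP => [|di]; first exact: h3.
have -> : i = d' by apply/eqP; rewrite eqn_leq id di.
case: ZZ' => s1 s2; split; first exact: subset_trans h2 s1.
by move=> s3; apply: s2; apply: subset_trans s3 h2.
Qed.

(** The transcendence degree grows strictly along a chain, so the member of index [j] has degree at
    least [j]. With [gdata_chain] this identifies dimension and transcendence degree. *)
Lemma gdata_zchain_le Z d e k : gdata Z d e -> zchain Z k -> (k <= d)%N.
Proof.
move=> g [Zs [h1 h2 h3]].
have H j : (j <= k)%N -> forall d e, gdata (Zs j) d e -> (j <= d)%N.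
  elim: j => // j IH hj d1 e1 g1.
  have [d' [e' g']] := zirr_gdata (h1 j (ltnW hj)).
  exact: leq_ltn_trans (IH (ltnW hj) _ _ g') (gdata_strict g1 g' (h3 _ hj)).
case: (classic (Z `<=` Zs k)) => s2.
  by apply: (H k (leqnn k) d e); rewrite (_ : Zs k = Z) //; apply/seteqP; split=> //; apply: h2.
have [d1 [e1 g1]] := zirr_gdata (h1 k (leqnn k)).
apply: leq_trans (H k (leqnn k) _ _ g1) _; apply: ltnW.
by apply: (gdata_strict g g1); split=> //; apply: h2.
Qed.

Lemma gdata_le_dim S Z d e p : zdim S p -> gdata Z d e -> Z `<=` S -> (d <= p)%N.
Proof.
move=> [_ np] g ZS; rewrite leqNgt; apply/negP => pd; apply: np.
exact: zchainW pd (gdata_chain g ZS).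
Qed.

Lemma gdata_zdim Z d e d' : gdata Z d e -> zdim Z d' -> d' = d.
Proof.
move=> g hd; apply/eqP; rewrite eqn_leq (gdata_le_dim hd g) // andbT.
exact: gdata_zchain_le g hd.1.
Qed.

Lemma point_irr A : zirr [set A].
Proof.
split; [|by exists A|].
  exists (vanishing [set A]); apply/seteqP; split=> B; first by move=> -> q; apply.
  move=> h; rewrite -(coK B) -(coK A) /=; congr oc; apply: boolp.funext => i.
  apply/eqP; rewrite -subr_eq0; apply/eqP.
  have := h ('X_i - (co A i)%:MP); rewrite mevalB mevalXU mevalC; apply.
  by move=> C ->; rewrite mevalB mevalXU mevalC subrr.
move=> Z1 Z2 _ _ e; have : (Z1 `|` Z2) A by rewrite -e.
case=> h; [left|right]; apply/seteqP; split=> B; try by move=> ->.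
  by move=> hB; rewrite e; left.
by move=> hB; rewrite e; right.
Qed.

(** The irreducible set [[set A]] is enlarged until it is a component; each enlargement raises the
    dimension, which [p] bounds. *)
Lemma component_cover S p A : zdim S p -> S A -> exists Z, zcomponent S Z /\ Z A.
Proof.
move=> hp SA.
have [d0 [e0 g0]] := zirr_gdata (point_irr A).
suff H n : forall Z d e, gdata Z d e -> Z `<=` S -> Z A -> (p - d < n)%N ->
    exists Z, zcomponent S Z /\ Z A.
  by apply: (H (p - d0).+1 _ _ _ g0) => // B ->.
elim: n => // n IH Z d e g ZS ZA; rewrite ltnS => pd.
case: (classic (zcomponent S Z)) => [|nc]; first by exists Z.
have [Z' [iZ' ZZ' Z'S ne]] : exists Z', [/\ zirr Z', Z `<=` Z', Z' `<=` S & Z' <> Z].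
  apply: NNPP => H; apply: nc; split=> //; first exact: gdata_irr g.
  by move=> Z' h1 h2 h3; apply: NNPP => ne; apply: H; exists Z'.
have [d' [e' g']] := zirr_gdata iZ'.
have dd' : (d < d')%N.
  apply: (gdata_strict g' g); split=> // Z'Z; apply: ne; exact/seteqP.
have d'p := gdata_le_dim hp g' Z'S.
by apply: (IH _ _ _ g') => //; [apply: ZZ'|lia].
Qed.

(** The [phi j] are arbitrary functions, not polynomials; this allows extension by zero in
    [spans_cover] and a choice of factorization in [spans_mul]. *)
Definition spans S m h := exists phi : 'I_h -> X -> K, forall G : {mpoly K[N]},
  (msize G <= m.+1)%N -> exists c : 'I_h -> K, forall A, S A ->
    meval (co A) G = \sum_j c j * phi j A.

Lemma gdata_spans Z d e m : gdata Z d e -> exists h, (h <= e * m.+1 ^ d)%N /\ spans Z m h.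
Proof.
move=> [L [emb [x [pr [eZ vZ -> ->]]]]].
set H := (_ * _)%N.
pose indep r (g : 'I_r -> {mpoly K[N]}) : Prop := (forall i, msize (g i) <= m.+1)%N /\
  forall c : 'rV[K]_r, vanishing Z (\sum_i c 0 i *: g i) -> c = 0.
have bound r g : @indep r g -> (r <= H)%N.
  move=> [gm gi]; rewrite leqNgt; apply/negP => hr.
  have [c [c0 ec]] := hilbert_bound gm hr.
  by case/eqP: c0; apply: gi => A; rewrite eZ; apply.
(* A maximal family independent on [Z] spans, since adding [G] creates a relation in which [G] has a
   nonzero coefficient. It exists because [H] bounds the size of independent families. *)
suff [r [g [ig mx]]] : exists r (g : 'I_r -> _), indep r g /\
    forall g' : 'I_r.+1 -> _, ~ indep r.+1 g'.
  exists r; split; first exact: bound ig.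
  exists (fun j A => meval (co A) (g j)) => G Gm.
  pose g' (i : 'I_r.+1) := if unlift ord0 i is Some j then g j else G.
  have [c [c0 vc]] : exists c : 'rV[K]_r.+1, c != 0 /\ vanishing Z (\sum_i c 0 i *: g' i).
    apply: NNPP => Hn; apply: (mx g'); split.
      by move=> i; rewrite /g'; case: unlift => // j; apply: ig.1.
    by move=> c vc; apply/eqP; apply: contra_notT Hn => c0; exists c.
  have c00 : c 0 ord0 != 0.
    apply: contraNneq c0 => c00; apply/eqP/rowP => i; rewrite mxE.
    case: (unliftP ord0 i) => [j ->|-> //].
    pose c' : 'rV_r := \row_j c 0 (lift ord0 j).
    have : c' = 0.
      apply: ig.2 => A ZA; have := vc A ZA.
      rewrite big_ord_recl c00 scale0r add0r => <-; congr meval.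
      by apply: eq_bigr => k _; rewrite mxE /g' liftK.
    by move=> /rowP /(_ j); rewrite !mxE.
  exists (fun j => - (c 0 (lift ord0 j) / c 0 ord0)) => A ZA.
  have := vc A ZA; rewrite big_ord_recl {1}/g' unlift_none mevalD mevalZ raddf_sum /=.
  move/eqP; rewrite addr_eq0 => /eqP e1.
  apply: (mulfI c00); rewrite e1 -sumrN mulr_sumr; apply: eq_bigr => j _.
  by rewrite mevalZ /g' liftK mulrA mulrN mulrCA divff // mulr1 mulNr.
have base : exists g : 'I_0 -> {mpoly K[N]}, indep 0%N g.
  by exists (fun=> 0); split=> [[]//|c _]; apply/rowP => -[].
apply: NNPP => Hn.
have all r : exists g : 'I_r -> {mpoly K[N]}, indep r g.
  elim: r => // r [g ig]; apply: NNPP => H'; apply: Hn; exists r, g; split=> //.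
  by move=> g' ig'; apply: H'; exists g'.
have [g /bound] := all H.+1; by rewrite ltnn.
Qed.

(** Each point is assigned to one set containing it, and the functions of a set are extended by zero
    to the points assigned elsewhere. *)
Lemma spans_cover S m (k : nat) (Zs : 'I_k -> set X) (hs : 'I_k -> nat) :
  (forall A, S A -> exists i, Zs i A) -> (forall i, spans (Zs i) m (hs i)) ->
  spans S m (\sum_i hs i).
Proof.
move=> cov sp.
have /all_sig [phi hphi] : forall i, {phi : 'I_(hs i) -> X -> K | forall G,
  (msize G <= m.+1)%N -> exists c : 'I_(hs i) -> K, forall A, Zs i A ->
    meval (co A) G = \sum_j c j * phi j A}.
  by move=> i; apply: boolp.cid; apply: sp.
pose idx A : option 'I_k := if boolp.pselect (exists i, Zs i A) is left h
  then Some (sval (boolp.cid h)) else None.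
pose T := {i : 'I_k & 'I_(hs i)}.
have cT : #|{: T}| = (\sum_i hs i)%N.
  by rewrite card_tagged sumnE big_map big_enum /=; apply: eq_bigr => i _; rewrite card_ord.
rewrite -cT; pose tg (j : 'I_#|{: T}|) : T := enum_val j.
exists (fun j A => if idx A == Some (tag (tg j)) then phi _ (tagged (tg j)) A else 0) => G Gm.
have /all_sig [c hc] : forall i, {c : 'I_(hs i) -> K | forall A, Zs i A ->
    meval (co A) G = \sum_j c j * phi i j A}.
  by move=> i; apply: boolp.cid; apply: hphi.
exists (fun j => c _ (tagged (tg j))) => A SA.
have [i [idxA ZA]] : exists i, idx A = Some i /\ Zs i A.
  rewrite /idx; case: boolp.pselect => [h|[]]; last exact: cov.
  by exists (sval (boolp.cid h)); split=> //; exact: (svalP (boolp.cid h)).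
pose Fn i (j : 'I_(hs i)) := c i j * (if idx A == Some i then phi i j A else 0).
transitivity (\sum_(u : T) Fn (tag u) (tagged u)); last first.
  by rewrite (big_enum_val (fun u : T => Fn (tag u) (tagged u))).
rewrite (hc i) // -(sig_big_dep (fun=> true) (fun _ _ => true) Fn) /= /Fn.
rewrite (bigD1 i) //= [X in _ + X]big1 => [|i' ne].
  by rewrite addr0; apply: eq_bigr => j _; rewrite idxA eqxx.
rewrite big1 // => j _; rewrite idxA; case: eqP => [[e]|_]; last by rewrite mulr0.
by rewrite e eqxx in ne.
Qed.

(** The section is the fibre of [y] over a good point. The [d] equations are independent because a
    relation between the rows of [pr_M] would be one between the [y]; the points are distinct
    because [theta] separates them. *)
Lemma gdata_section Z d e : gdata Z d e ->
  exists (M : 'M[K]_(d, N)) (a : 'I_d -> K) (pts : seq X),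
  [/\ \rank M = d, uniq pts, size pts = e &
      forall A, (Z A /\ forall i, \sum_j M i j * co A j = a i) <-> A \in pts].
Proof.
move=> [L [emb [x [pr [eZ vZ -> ->]]]]].
have [a [ts [pt [uts sts h1 h2]]]] := fibre pr.
exists (pr_M pr), a, [seq oc (pt t) | t <- ts]; split.
- apply/eqP; rewrite -[_ == _]/(row_free _); apply: contraT.
  rewrite -kermx_eq0 => /rowV0Pn [u /sub_kermxP uM u0].
  case/eqP: u0; apply/rowP => i; rewrite mxE.
  pose f : {mpoly K[pr_s pr]} := \sum_i u 0 i *: 'X_i.
  have : f = 0.
    apply: (@pr_indep _ _ _ _ _ pr); rewrite raddf_sum /=.
    transitivity (\sum_j emb ((u *m pr_M pr) 0 j) * x j); last first.
      by rewrite big1 // => j _; rewrite uM mxE rmorph0 mul0r.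
    under [RHS]eq_bigr do rewrite mxE rmorph_sum mulr_suml.
    rewrite exchange_big; apply: eq_bigr => k _ /=.
    rewrite mmapZ mmapX mmap1U mulr_sumr; apply: eq_bigr => j _.
    by rewrite rmorphM mulrA.
  move/(congr1 (mcoeff U_(i)%MM)); rewrite raddf_sum mcoeff0 /= (bigD1 i) //=.
  rewrite mcoeffZ mcoeffXU eqxx mulr1 big1 ?addr0 // => k /negbTE ki.
  by rewrite mcoeffZ mcoeffXU ki mulr0.
- rewrite map_inj_in_uniq // => t1 t2 /h1 [_ _ e1] /h1 [_ _ e2] e12.
  by rewrite -e1 -e2 -(ocK (pt t1)) e12 ocK.
- by rewrite size_map.
move=> A; split.
  move=> [ZA MA]; rewrite eZ in ZA.
  have [h3 h4] := h2 (co A) ZA MA.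
  apply/mapP; exists (pr_th pr).@[co A] => //.
  by rewrite -[LHS]coK; congr oc; apply: boolp.funext.
move=> /mapP [t /h1 [h3 h4 h5] ->]; by rewrite eZ /= ocK.
Qed.

End AffineGeometry.
End AffineGeometry.

(** * Counting by spanning families *)

Module SpanningFamilies.
Import mpoly MpolyFacts WeightedDegree NoetherNormalization AffineGeometry.
From mathcomp Require Import classical_sets.
Local Open Scope classical_set_scope.

Section SpanningFamilies.
Variables (K : numClosedFieldType) (N : nat) (X : eqType).
Variables (co : X -> 'I_N -> K) (oc : ('I_N -> K) -> X).
Hypothesis (coK : forall A, oc (co A) = A).
Local Notation spans := (spans co).

Definition deg_le d (Q : {mpoly K[N]}) : bool := (msize Q <= d.+1)%N.

(** The values of the [Q g] at the [C f] form an identity matrix of size [#|T|], which factors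
    through dimension [h]. *)
Lemma spans_count S m h (T : finType) (C : T -> X) (Q : T -> {mpoly K[N]}) :
  spans S m h -> (forall f, S (C f)) -> (forall g, deg_le m (Q g)) ->
  (forall f g, meval (co (C f)) (Q g) = (f == g)%:R) -> (#|T| <= h)%N.
Proof.
move=> [phi hphi] SC sQ CQ.
have /all_sig [c hc] : forall g, {c : 'I_h -> K | forall A, S A ->
    meval (co A) (Q g) = \sum_j c j * phi j A}.
  by move=> g; apply: boolp.cid; apply: hphi; exact: sQ.
pose W1 := \matrix_(g < #|T|, j < h) c (enum_val g) j.
pose W2 := \matrix_(j < h, f < #|T|) phi j (C (enum_val f)).
have e : W1 *m W2 = 1%:M.
  apply/matrixP => g f; rewrite !mxE.
  under eq_bigr do rewrite !mxE.
  by rewrite -hc // CQ (inj_eq enum_val_inj) eq_sym.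
have := mxrankM_maxl W1 W2; rewrite e mxrank1 => /leq_trans; apply.
exact: rank_leq_col.
Qed.

(** If a single function spans, the constant [1] makes it constant and nonzero on [S], and then
    every coordinate is constant there. Degree at least 1 brings in the coordinates. *)
Lemma spans_le1 S m h A B : spans S m.+1 h -> (h <= 1)%N -> S A -> S B -> A = B.
Proof.
move=> [phi hphi] h1 SA SB.
have [|c1 e1] := hphi 1; first by rewrite msize1.
case: h h1 phi hphi c1 e1 => [|[|//]] _ phi hphi c1 e1.
  by have /eqP := e1 A SA; rewrite meval1 big_ord0 oner_eq0.
have {}e1 C : S C -> c1 ord0 * phi ord0 C = 1.
  by move=> SC; have := e1 C SC; rewrite meval1 big_ord1.
have c0 : c1 ord0 != 0.
  by apply/eqP => c0; have /eqP := e1 A SA; rewrite c0 mul0r eq_sym oner_eq0.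
have e2 : phi ord0 A = phi ord0 B by apply: (mulfI c0); rewrite !e1.
rewrite -(coK A) -(coK B); congr oc; apply: boolp.funext => k.
have [|c h2] := hphi 'X_k; first by rewrite msizeX mdeg1.
by have := h2 A SA; have := h2 B SB; rewrite !mevalXU !big_ord1 e2 => -> ->.
Qed.

Lemma monomial_poly (ks : seq 'I_N) : exists Q : {mpoly K[N]},
  deg_le (size ks) Q /\ forall A, meval (co A) Q = \prod_(k <- ks) co A k.
Proof.
rewrite /deg_le; elim: ks => [|k ks [Q [sQ hQ]]].
  by exists 1; rewrite msize1; split=> // A; rewrite meval1 big_nil.
exists ('X_k * Q); split; last by move=> A; rewrite mevalM mevalXU hQ big_cons.
have [->|Q0] := eqVneq Q 0; first by rewrite mulr0 msize0.
rewrite msizeM //; last by rewrite -msize_poly_eq0 msizeX.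
by rewrite msizeX mdeg1 /= !addSn add0n ltnS.
Qed.

Variables (mul : X -> X -> X) (J : finType) (f g : 'I_N -> J -> 'I_N).
Hypothesis mulE : forall A B k,
  co (mul A B) k = \sum_r co A (f k r) * co B (g k r).

Definition bipoly d (w : X -> X -> K) := exists l : seq ({mpoly K[N]} * {mpoly K[N]}),
  (forall p, p \in l -> (msize p.1 <= d.+1)%N /\ (msize p.2 <= d.+1)%N) /\
  forall A B, w A B = \sum_(p <- l) meval (co A) p.1 * meval (co B) p.2.

Lemma msizeM_deg d d' (p q : {mpoly K[N]}) :
  (msize p <= d.+1)%N -> (msize q <= d'.+1)%N -> (msize (p * q) <= (d + d').+1)%N.
Proof.
move=> hp hq; have [->|p0] := eqVneq p 0; first by rewrite mul0r msize0.
have [->|q0] := eqVneq q 0; first by rewrite mulr0 msize0.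
by rewrite msizeM //; move: hp hq; move: (msize p) (msize q) => u v; lia.
Qed.

Lemma bipoly_ext d w w' : (forall A B, w A B = w' A B) -> bipoly d w -> bipoly d w'.
Proof. by move=> e [l [h1 h2]]; exists l; split=> // A B; rewrite -e. Qed.

Lemma bipolyW d d' w : (d <= d')%N -> bipoly d w -> bipoly d' w.
Proof.
move=> dd [l [h1 h2]]; exists l; split=> // p /h1 [a b].
by split; [apply: leq_trans a _|apply: leq_trans b _].
Qed.

Lemma bipolyC c : bipoly 0 (fun _ _ => c).
Proof.
exists [:: (c%:MP, 1)]; split.
  move=> p; rewrite inE => /eqP -> /=; rewrite msize1 msizeC.
  by case: (_ != _).
by move=> A B; rewrite big_seq1 /= mevalC meval1 mulr1.
Qed.

Lemma bipolyD d w w' : bipoly d w -> bipoly d w' -> bipoly d (fun A B => w A B + w' A B).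
Proof.
move=> [l [h1 h2]] [l' [h1' h2']]; exists (l ++ l'); split.
  by move=> p; rewrite mem_cat => /orP[/h1|/h1'].
by move=> A B; rewrite big_cat /= h2 h2'.
Qed.

Lemma bipoly_sum d (I : Type) (r : seq I) (w : I -> X -> X -> K) :
  (forall i, bipoly d (w i)) -> bipoly d (fun A B => \sum_(i <- r) w i A B).
Proof.
move=> h; elim: r => [|i r IH].
  apply: (bipoly_ext (w := fun _ _ => 0)); first by move=> A B; rewrite big_nil.
  exact: bipolyW (bipolyC 0).
apply: (bipoly_ext (w := fun A B => w i A B + \sum_(i <- r) w i A B)).
  by move=> A B; rewrite big_cons.
exact: bipolyD.
Qed.

Lemma bipolyM d d' w w' : bipoly d w -> bipoly d' w' ->
  bipoly (d + d') (fun A B => w A B * w' A B).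
Proof.
move=> [l [h1 h2]] [l' [h1' h2']].
exists [seq (p.1 * q.1, p.2 * q.2) | p <- l, q <- l']; split.
  move=> p /allpairsP [[p1 p2] /= [/h1 [a b] /h1' [a' b'] ->]] /=.
  by split; apply: msizeM_deg.
move=> A B; rewrite big_allpairs_dep h2 h2' mulr_suml; apply: eq_bigr => p _.
by rewrite mulr_sumr; apply: eq_bigr => q _ /=; rewrite !mevalM mulrACA.
Qed.

(** Each coordinate of the product is bilinear, hence of degree 1 in either factor, so the degree in
    each factor stays at most [m]. *)
Lemma bipoly_mul m (G : {mpoly K[N]}) : (msize G <= m.+1)%N ->
  bipoly m (fun A B => meval (co (mul A B)) G).
Proof.
have bX k : bipoly 1 (fun A B => co (mul A B) k).
  apply: (bipoly_ext (w := fun A B => \sum_r co A (f k r) * co B (g k r))).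
    by move=> A B; rewrite mulE.
  apply: bipoly_sum => r; exists [:: ('X_(f k r), 'X_(g k r))]; split.
    by move=> p; rewrite inE => /eqP -> /=; rewrite !msizeX !mdeg1.
  by move=> A B; rewrite big_seq1 /= !mevalXU.
have bXn k a : bipoly a (fun A B => co (mul A B) k ^+ a).
  elim: a => [|a IH]; first exact: (bipoly_ext (w := fun _ _ => 1)) (bipolyC 1).
  apply: (bipoly_ext (w := fun A B => co (mul A B) k * co (mul A B) k ^+ a)).
    by move=> A B; rewrite exprS.
  exact: (bipolyM (bX k) IH).
have bmon (u : 'X_{1..N}) : bipoly (mdeg u) (fun A B => \prod_k co (mul A B) k ^+ u k).
  rewrite mdegE; elim: (index_enum _) => [|k r IH].
    apply: (bipoly_ext (w := fun _ _ => 1)); first by move=> A B; rewrite big_nil.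
    by rewrite big_nil; apply: bipolyC.
  rewrite big_cons; apply: (bipoly_ext (w := fun A B => co (mul A B) k ^+ u k *
     \prod_(i <- r) co (mul A B) i ^+ u i)); last exact: (bipolyM (bXn k _) IH).
  by move=> A B; rewrite big_cons.
(* The condition always holds on the support of [G]; it is written into the summand so that the
   degree bound holds for every index. *)
move=> sG; apply: (bipoly_ext (w := fun A B => \sum_(u <- msupp G)
    (if (mdeg u <= m)%N then G@_u else 0) * \prod_k co (mul A B) k ^+ u k)).
  move=> A B; rewrite mevalE big_seq [RHS]big_seq; apply: eq_bigr => u hu.
  by rewrite -ltnS (leq_trans (msize_mdeg_lt hu) sG).
apply: bipoly_sum => u; case: leqP => hu.
  by apply: bipolyW hu _; rewrite -[mdeg u]add0n; apply: bipolyM (bipolyC _) (bmon u).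
apply: (bipoly_ext (w := fun _ _ => 0)); first by move=> A B; rewrite mul0r.
exact: bipolyW (bipolyC 0).
Qed.

(** A factorization of each product is chosen once and for all; the products [phi i * psi j],
    evaluated at the chosen factors, then span. *)
Lemma spans_mul S S' m h h' : spans S m h -> spans S' m h' ->
  spans [set C | exists A B, [/\ S A, S' B & C = mul A B]] m (h * h').
Proof.
move=> [phi hphi] [psi hpsi].
pose fac C : X * X := if boolp.pselect (exists AB : X * X, [/\ S AB.1, S' AB.2 & C = mul AB.1 AB.2])
  is left e then sval (boolp.cid e) else (C, C).
have facP C : (exists A B, [/\ S A, S' B & C = mul A B]) ->
    [/\ S (fac C).1, S' (fac C).2 & C = mul (fac C).1 (fac C).2].
  move=> [A [B hAB]]; rewrite /fac; case: boolp.pselect => [e|[]]; last by exists (A, B).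
  exact: (svalP (boolp.cid e)).
have cT : #|{: 'I_h * 'I_h'}| = (h * h')%N by rewrite card_prod !card_ord.
rewrite -cT; exists (fun j C => phi (enum_val j).1 (fac C).1 * psi (enum_val j).2 (fac C).2).
move=> G sG; have [l [h1 h2]] := bipoly_mul sG.
have cS (p : {mpoly K[N]} * {mpoly K[N]}) : p \in l -> exists c : 'I_h -> K,
    forall A, S A -> meval (co A) p.1 = \sum_j c j * phi j A.
  by move=> /h1 [a _]; apply: hphi.
have cS' (p : {mpoly K[N]} * {mpoly K[N]}) : p \in l -> exists c : 'I_h' -> K,
    forall A, S' A -> meval (co A) p.2 = \sum_j c j * psi j A.
  by move=> /h1 [_ a]; apply: hpsi.
have [c hc] : exists c : 'I_h * 'I_h' -> K, forall A B, S A -> S' B ->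
    \sum_(p <- l) meval (co A) p.1 * meval (co B) p.2 =
    \sum_j c j * (phi j.1 A * psi j.2 B).
  elim: (l) cS cS' => [|p r IH] c1 c2.
    by exists (fun=> 0) => A B _ _; rewrite big_nil big1 // => j _; rewrite mul0r.
  have [c hc] := IH (fun q hq => c1 q (mem_behead (s := p :: r) hq))
                    (fun q hq => c2 q (mem_behead (s := p :: r) hq)).
  have [d hd] := c1 p (mem_head _ _); have [d' hd'] := c2 p (mem_head _ _).
  exists (fun j => d j.1 * d' j.2 + c j) => A B SA SB.
  rewrite big_cons hc // hd // hd' //.
  under [RHS]eq_bigr do rewrite mulrDl; rewrite big_split /=; congr (_ + _).
  rewrite mulr_suml -(pair_bigA _ (fun i j => d i * d' j * (phi i A * psi j B))) /=.
  by apply: eq_bigr => i _; rewrite mulr_sumr; apply: eq_bigr => j _; rewrite mulrACA.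
exists (fun j => c (enum_val j)) => C /facP [SA SB eC].
rewrite {1}eC h2 hc // (big_enum_val (fun j => c j * (phi j.1 (fac C).1 * psi j.2 (fac C).2))) //.
Qed.

End SpanningFamilies.
End SpanningFamilies.

Require Import Defs.
From HB Require Import structures.
From mathcomp Require Import all_boot all_order all_algebra.
From mathcomp Require Import all_classical all_reals all_analysis.
From mathcomp Require Import complex.
Import Order.TTheory GRing.Theory Num.Theory.
Local Open Scope ring_scope.
Local Open Scope classical_set_scope.

(** * Transfer to sets of operators: spanning families bounded by dimension and degree *)

Module EndSpaces.
Import AffineGeometry SpanningFamilies.

Section EndSpaces.
Variables (R : realType) (n : nat).
Local Notation N := (qdim n * qdim n)%N.
Local Notation co := (@coords R n).
Implicit Types (Z S : set (End_ R n)).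

Definition of_coords (z : 'I_N -> R[i]) : End_ R n := vec_mx (\row_k z k).

Lemma of_coordsK z : co (of_coords z) = z.
Proof. by apply: funext => k; rewrite /coords /of_coords vec_mxK mxE. Qed.

Lemma coordsK A : of_coords (co A) = A.
Proof.
rewrite /of_coords -[RHS]mxvecK; congr vec_mx.
by apply/rowP => k; rewrite mxE.
Qed.

Lemma section_affine d (M : 'M[R[i]]_(d, N)) (a : 'I_d -> R[i]) A0 : \rank M = d ->
  (forall i, \sum_j M i j * co A0 j = a i) ->
  affine_subspace (N - d) [set A | forall i, \sum_j M i j * co A j = a i].
Proof.
move=> rM hA0.
have eN : (N - d)%N = \rank (kermx M^T) by rewrite mxrank_ker mxrank_tr rM.
rewrite eN; pose W := row_base (kermx M^T).
exists A0, (fun i => vec_mx (row i W)); split.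
  suff -> : \matrix_(i < \rank (kermx M^T)) mxvec (vec_mx (row i W)) = W.
    by apply/eqP; exact: row_base_free.
  by apply/row_matrixP => i; rewrite rowK vec_mxK.
have mulT (A : End_ R n) i : (mxvec A *m M^T) 0 i = \sum_j M i j * co A j.
  by rewrite mxE; apply: eq_bigr => j _; rewrite mxE mulrC.
apply/seteqP; split=> [A hA|_ [u _ <-]] /=.
  have : (mxvec (A - A0) <= W)%MS.
    rewrite eq_row_base; apply/sub_kermxP/rowP => i.
    by rewrite linearB /= mulmxBl [LHS]mxE [X in _ + X]mxE !mulT hA hA0 subrr mxE.
  move=> /submxP [D eD]; exists (fun i => D 0 i) => //.
  apply/eqP; rewrite eq_sym addrC -subr_eq; apply/eqP; rewrite -[LHS]mxvecK eD.
  rewrite mulmx_sum_row linear_sum /=; apply: eq_bigr => i _.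
  by rewrite linearZ.
move=> i; rewrite -mulT linearD /= mulmxDl mxE mulT hA0 linear_sum /= mulmx_suml summxE.
rewrite big1 ?addr0 // => j _; rewrite linearZ /= vec_mxK -scalemxAl.
suff -> : row j W *m M^T = 0 by rewrite scaler0 mxE.
apply/sub_kermxP; apply: submx_trans (row_sub _ _) _.
by rewrite eq_row_base.
Qed.

(** The fibre of [y] competes in the maximum that defines the degree; by [gdata_zdim] it has the
    codimension prescribed there. *)
Lemma gdata_degree Z d e c : gdata co Z d e -> irr_degree Z c -> (e <= c)%N.
Proof.
move=> g [d' [_ hd _ hmax]].
have ed : d' = d := gdata_zdim of_coordsK g hd.
rewrite ed in hmax.
have [M [a [pts [rM upts spts hpts]]]] := gdata_section of_coordsK coordsK g.
(* Without points [e] is 0 and the bound trivial; otherwise a point serves as origin of the affine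
   subspace. *)
case: pts upts spts hpts => [_ <- //|A0 pts] upts spts hpts.
have [_ hA0] := (hpts A0).2 (mem_head _ _).
apply: hmax (section_affine rM hA0) _.
exists (A0 :: pts); split=> //; split=> //.
by apply/seteqP; split=> A /=; [move=> hA; apply/hpts|move/hpts].
Qed.

Lemma degree_spans Delta p D m : has_dim Delta p -> has_degree Delta D ->
  exists h, (h <= D * m.+1 ^ p)%N /\ spans co Delta m h.
Proof.
move=> hp [k [Zs [cs [_ h1 h2 h3 ->]]]].
have /all_sig [hs hhs] : forall i, {h | (h <= cs i * m.+1 ^ p)%N /\ spans co (Zs i) m h}.
  move=> i; apply: cid; have [iZ ZD _] := h1 i.
  have [d [e g]] := zirr_gdata (co := co) iZ.
  have [h [hh sp]] := gdata_spans m g; exists h; split=> //.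
  apply: leq_trans hh _; apply: leq_mul; first exact: gdata_degree g (h3 i).
  exact: (leq_pexp2l _ (gdata_le_dim of_coordsK hp g ZD)).
exists (\sum_i hs i)%N; split.
  by rewrite big_distrl; apply: leq_sum => i _; case: (hhs i).
apply: (spans_cover (Zs := Zs)) => [A DA|i]; last by case: (hhs i).
have [Z [cZ ZA]] := component_cover of_coordsK coordsK hp DA.
by have [i e] := h2 Z cZ; exists i; rewrite -e.
Qed.

End EndSpaces.
End EndSpaces.

(** * Circuits *)

Module Circuits.
Import AffineGeometry SpanningFamilies EndSpaces.

Lemma odd_digits n (v : nat -> bool) :
  exists2 x, (x < 2 ^ n)%N & forall i, (i < n)%N -> odd (x %/ 2 ^ i) = v i.
Proof.
elim: n v => [|n IH] v; first by exists 0%N.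
have [x hx ex] := IH (fun i => v i.+1).
exists (v 0%N + x.*2)%N.
  by rewrite expnS mul2n; move: hx; case: (v 0%N); rewrite -!muln2; lia.
case=> [|i] hi; first by rewrite divn1 oddD odd_double addbF; case: (v 0%N).
rewrite expnS divnMA -ex //; congr (odd (_ %/ _)).
by rewrite divn2 half_bit_double.
Qed.

Section Circuits.
Variables (R : realType) (n : nat).
Local Notation co := (@coords R n).
Local Notation fT := ({ffun {ffun 'I_n -> bool} -> bool}).
Implicit Types (f g : {ffun 'I_n -> bool} -> bool).

Lemma bits_surj (v : {ffun 'I_n -> bool}) : exists2 x, (x < 2 ^ n)%N & bits n x = v.
Proof.
have [x hx ex] := odd_digits n (fun i => if insub i is Some j then v j else false).
exists x => //; apply/ffunP => i; rewrite ffunE ex //.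
by rewrite valK.
Qed.

Lemma idx_lt x (b : bool) : (x < 2 ^ n)%N -> (b + x.*2 < qdim n)%N.
Proof. by rewrite /qdim expnS mul2n -!muln2; case: b; lia. Qed.

Definition idx x (b : bool) (h : (x < 2 ^ n)%N) : 'I_(qdim n) := Ordinal (idx_lt b h).

Lemma idx_half x b (h : (x < 2 ^ n)%N) : (idx b h %/ 2 = x)%N.
Proof. by rewrite /= divn2 half_bit_double. Qed.

Lemma idx_odd x b (h : (x < 2 ^ n)%N) : odd (idx b h) = b.
Proof. by rewrite /= oddD odd_double addbF; case: b. Qed.

Lemma half_lt (c : 'I_(qdim n)) : (c %/ 2 < 2 ^ n)%N.
Proof. by rewrite ltn_divLR // mulnC -expnS. Qed.

Lemma idxE (c : 'I_(qdim n)) : c = idx (odd c) (half_lt c).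
Proof. by apply/val_inj; rewrite /= divn2 odd_double_half. Qed.

Lemma U_idx f x b h y b' h' :
  @U_ R n f (@idx x b h) (@idx y b' h') = ((x == y) && (b == f (bits n y) (+) b'))%:R.
Proof. by rewrite mxE !idx_half !idx_odd. Qed.

Lemma indicator_poly : exists Q : fT -> poly_End R n,
  (forall g : fT, deg_le (2 ^ n) (Q g)) /\
  forall f (g : fT), mpoly.meval (co (U_ R f)) (Q g) = (finfun f == g)%:R.
Proof.
(* The entry in row [|x>|g(x)>] and column [|x>|0>], for each [x]. *)
pose ks (g : fT) := [seq mxvec_index (idx (g (bits n x)) (ltn_ord x)) (idx false (ltn_ord x))
  | x : 'I_(2 ^ n) <- enum 'I_(2 ^ n)].
have /all_sig [Q hQ] : forall g : fT, {Q : poly_End R n |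
    deg_le (size (ks g)) Q /\
    forall A, mpoly.meval (co A) Q = \prod_(k <- ks g) co A k}.
  by move=> g; apply: cid; apply: monomial_poly.
exists Q; split=> [g|f g].
  by have [] := hQ g; rewrite size_map size_enum_ord.
have [_ ->] := hQ g; rewrite big_map big_enum /=.
under eq_bigr => x _ do rewrite /coords mxvecE U_idx eqxx addbF /=.
case: eqP => [<-|ne]; first by rewrite big1 // => x _; rewrite ffunE eqxx.
have [v hv] : exists v, g v != f v.
  apply: NNPP => H; apply: ne; apply/ffunP => v; rewrite ffunE; apply/eqP.
  by rewrite eq_sym; apply: contra_notT H => ?; exists v.
have [x hx ex] := bits_surj v.
by rewrite (bigD1 (Ordinal hx)) //= ex (negbTE hv) mul0r.
Qed.

Lemma U_inj f g : U_ R f = U_ R g -> f =1 g.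
Proof.
have [Q [_ hQ]] := indicator_poly => e v.
have := hQ f (finfun g); rewrite e hQ eqxx.
case: eqP => [/ffunP /(_ v)|_ /eqP]; first by rewrite !ffunE => ->.
by rewrite oner_eq0.
Qed.

Lemma U_false : U_ R (fun _ : {ffun 'I_n -> bool} => false) = 1.
Proof.
apply/matrixP => r c; rewrite (idxE r) (idxE c) U_idx /= !mxE; congr (_%:R).
congr nat_of_bool; apply/andP/eqP => [[/eqP e1 /eqP e2]|e].
  by apply/val_inj; rewrite /= e1 e2.
have e1 := congr1 val e; move: e1; rewrite /= !divn2 !odd_double_half => e1.
by rewrite e1 !eqxx.
Qed.

Lemma U_involution f : U_ R f * U_ R f = 1.
Proof.
rewrite -U_false; apply/matrixP => r c; rewrite (idxE r) (idxE c) U_idx !mxE.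
set y := (c %/ 2)%N; set b := odd c; set hy := half_lt c.
rewrite (bigD1 (idx (f (bits n y) (+) b) hy)) //= !U_idx eqxx eqxx mulr1 addbA addbb.
rewrite big1 ?addr0 // => k; rewrite (idxE k) U_idx => ne.
rewrite [X in _ * X](_ : _ = 0) ?mulr0 // U_idx.
case: andP => // -[/eqP e1 /eqP e2]; case/eqP: ne; apply/val_inj => /=.
by rewrite e1 e2.
Qed.

(** Index [t] stands for products of [t.+1] elements; the empty product does not occur. *)
Fixpoint products (Delta : set (End_ R n)) t : set (End_ R n) :=
  if t is t'.+1 then [set C | exists A B, [/\ Delta A, products Delta t' B & C = A * B]]
  else Delta.

Lemma factors_products Delta U t : factors_in Delta U t.+1 -> products Delta t U.
Proof.
move=> [_ [al [hal ->]]]; elim: t al hal => [|t IH] al hal.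
  by rewrite big_ord1; apply: hal.
rewrite big_ord_recl; exists (al ord0), (\prod_(i < t.+1) al (lift ord0 i)).
by split=> //; apply: IH.
Qed.

Lemma mulE : exists F G : 'I_(qdim n * qdim n) -> 'I_(qdim n) -> 'I_(qdim n * qdim n),
  forall (A B : End_ R n) k, co (A * B) k = \sum_r co A (F k r) * co B (G k r).
Proof.
have /all_sig [ij hij] : forall k : 'I_(qdim n * qdim n),
    {ij : 'I_(qdim n) * 'I_(qdim n) | k = mxvec_index ij.1 ij.2}.
  by move=> k; apply: cid; case/mxvec_indexP: k => i j; exists (i, j).
exists (fun k r => mxvec_index (ij k).1 r), (fun k r => mxvec_index r (ij k).2) => A B k.
rewrite /coords {1}(hij k) mxvecE mxE; apply: eq_bigr => r _.
by rewrite !mxvecE.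
Qed.

Lemma products_spans Delta m h t : spans co Delta m h ->
  spans co (products Delta t) m (h ^ t.+1).
Proof.
have [F [G FG]] := mulE.
move=> sp; elim: t => [|t IH]; first by rewrite expn1.
by rewrite expnS; apply: (spans_mul FG).
Qed.

Lemma count_products Delta h t : spans co Delta (2 ^ n) h ->
  (#|[pred u : fT | `[< products Delta t (U_ R u) >]]| <= h ^ t.+1)%N.
Proof.
move=> sp; have [Q [sQ hQ]] := indicator_poly.
set P := [pred u : fT | _].
pose T := {u : fT | u \in P}.
have H : (#|{: T}| <= h ^ t.+1)%N.
  apply: (spans_count (T := T) (C := fun u : T => U_ R (val u))
    (Q := fun u : T => Q (val u)) (products_spans t sp)) => [[f hf]|g|f g] //=.
    by apply/asboolP; move: hf; rewrite inE.
  rewrite hQ -val_eqE /=; congr (_%:R); congr nat_of_bool; congr (_ == _).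
  by apply/ffunP => v; rewrite ffunE.
by rewrite card_sig in H.
Qed.

End Circuits.

(* Both powers equal [a ^+ gcdn s t]. *)
Lemma power_involution (A : pzRingType) (a : A) s t : (0 < s)%N -> (0 < t)%N ->
  a ^+ s != 1 -> a ^+ t != 1 -> a ^+ s * a ^+ s = 1 -> a ^+ t * a ^+ t = 1 ->
  a ^+ s = a ^+ t.
Proof.
move=> s0 t0 s1 t1; rewrite -!exprD !addnn => s2 t2; set g := gcdn s t.
have g2 : a ^+ g.*2 = 1.
  (* Bezout gives [u * s = v * t + g]; after doubling, [u * s] and [v * t] contribute the factor
     1. *)
  have [u v e _] := egcdnP t s0.
  have : a ^+ (u * s).*2 = 1 by rewrite doubleMr mulnC exprM s2 expr1n.
  rewrite e doubleD doubleMr exprD (mulnC v) exprM t2 expr1n mul1r; exact.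
(* Only the parity of [r / g] matters, and an even quotient would make the power 1. *)
have red r : (g %| r)%N -> a ^+ r != 1 -> a ^+ r = a ^+ g.
  move=> /dvdnP [k ->]; rewrite -{1 2}[k]odd_double_half mulnDl -doubleMl.
  rewrite exprD mulnC [(k./2 * g).*2](_ : _ = g.*2 * k./2)%N; last first.
    by rewrite -!muln2; lia.
  rewrite exprM [a ^+ (g.*2 * _)]exprM g2 expr1n mulr1.
  by case: (odd k); rewrite ?expr1 // expr0 eqxx.
by rewrite (red s (dvdn_gcdl s t) s1) (red t (dvdn_gcdr s t) t1).
Qed.

End Circuits.

(** * Counting all Boolean functions *)

Module LowerBound.
Import AffineGeometry SpanningFamilies EndSpaces Circuits.

Lemma sum_expn_lt H T : (1 < H)%N -> (\sum_(t < T) H ^ t.+1 < H ^ T.+1)%N.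
Proof.
move=> H1; elim: T => [|T IH]; first by rewrite big_ord0 expn_gt0 (ltnW H1).
rewrite big_ord_recr /= [X in (_ < X)%N]expnS; apply: (@leq_trans (H ^ T.+1 + H ^ T.+1)%N).
  by rewrite ltn_add2r.
by rewrite addnn -mul2n leq_mul2r H1 orbT.
Qed.

Section LowerBound.
Variables (R : realType) (n : nat).
Local Notation co := (@coords R n).
Local Notation fT := ({ffun {ffun 'I_n -> bool} -> bool}).

Lemma count_all (Delta : set (End_ R n)) h T : spans co Delta (2 ^ n) h ->
  (forall f : fT, exists t, (t < T)%N /\ products Delta t (U_ R f)) ->
  (2 ^ 2 ^ n <= \sum_(t < T) h ^ t.+1)%N.
Proof.
move=> sp hall.
have -> : (2 ^ 2 ^ n)%N = #|{: fT}| by rewrite card_ffun card_bool card_ffun card_bool card_ord.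
pose F t := [pred u : fT | `[< products Delta t (U_ R u) >]].
apply: (@leq_trans (\sum_(t < T) #|F t|)); last first.
  by apply: leq_sum => t _; apply: count_products.
rewrite -sum1_card; under [X in (_ <= X)%N]eq_bigr do rewrite -sum1_card big_mkcond.
rewrite exchange_big; apply: leq_sum => f _.
have [t [tT ht]] := hall f.
rewrite (bigD1 (Ordinal tT)) //= inE.
by move/asboolP: ht => ->.
Qed.

Lemma ln2_ge : 2^-1 <= ln 2 :> R.
Proof.
have := @le_ln1Dx R (- 2^-1); rewrite (_ : 1 + - 2^-1 = 2^-1); last by lra.
rewrite lnV ?posrE ?ltr0n // lerN2; apply; lra.
Qed.

Lemma ln2_le : ln 2 <= 1 :> R.
Proof. by have := @le_ln1Dx R 1; rewrite (_ : 1 + 1 = 2) //; apply; lra. Qed.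

(* [maxn D 1] because [ln 0 = 0] here. *)
Lemma ln_base_le p D : (0 < n)%N ->
  ln ((maxn D 1 * (2 ^ n).+1 ^ p)%N%:R : R) <= 2 * (p%:R * n%:R + ln D%:R).
Proof.
move=> n0.
have D0 : 0 <= ln (D%:R : R).
  case: D => [|D]; first by rewrite ln0.
  by apply: ln_ge0; rewrite ler1n.
have -> : ln (D%:R : R) = ln ((maxn D 1)%:R : R).
  by case: D {D0} => [|D]; [rewrite ln0 // ln1|rewrite (maxn_idPl _)].
have D1 : 0 < (maxn D 1)%:R :> R by rewrite ltr0n; lia.
have b0 : 0 < (2 ^ n).+1%:R :> R by rewrite ltr0n.
rewrite natrM natrX lnM ?posrE ?exprn_gt0 // lnXn // -[ln _ *+ p]mulr_natl.
(* From [2 ^ n + 1 <= 2 ^ (n + 1)], [ln 2 <= 1] and [n + 1 <= 2 n], where [n > 0] enters. *)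
have lb : ln ((2 ^ n).+1%:R : R) <= 2 * n%:R.
  apply: (@le_trans _ _ (ln (2%:R ^+ n.+1))).
    rewrite ler_ln ?posrE ?exprn_gt0 // -natrX ler_nat expnS mul2n -addnn.
    by rewrite -addn1 leq_add2l expn_gt0.
  rewrite lnXn // -[ln _ *+ _]mulr_natl; apply: (@le_trans _ _ (n.+1%:R * 1)).
    by apply: ler_wpM2l; [rewrite ler0n|exact: ln2_le].
  by rewrite mulr1 -natrM ler_nat; lia.
have Dm : ln (maxn D 1)%:R <= 2 * ln ((maxn D 1)%:R : R).
  suff : 0 <= ln ((maxn D 1)%:R : R) by lra.
  by apply: ln_ge0; rewrite ler1n; lia.
have pl : p%:R * ln ((2 ^ n).+1%:R : R) <= p%:R * (2 * n%:R) by apply: ler_wpM2l; rewrite ?ler0n.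
by apply: le_trans (lerD Dm pl) _; rewrite le_eqVlt; apply/orP; left; apply/eqP; ring.
Qed.

Lemma single_point (Delta : set (End_ R n)) : (0 < n)%N ->
  (forall A B, Delta A -> Delta B -> A = B) ->
  ~ (forall f : fT, exists t, factors_in Delta (U_ R f) t).
Proof.
move=> n0 D1 hall.
have pow f t : factors_in Delta (U_ R f) t -> forall A, Delta A -> U_ R f = A ^+ t.
  move=> [_ [al [hal ->]]] A hA.
  under eq_bigr => i _ do rewrite (D1 _ _ (hal i) hA).
  by rewrite prodr_const card_ord.
(* Two nonzero functions, so that neither operator is 1; as [n > 0], they differ at the all-true
   vector. *)
pose f1 : fT := [ffun => true].
pose f2 : fT := [ffun v => v == [ffun => false]].
have [t1 h1] := hall f1; have [t2 h2] := hall f2.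
have [t10 [al [hal _]]] := h1; have t20 := h2.1.
have hA := hal (Ordinal t10); set A := al _ in hA.
have e1 := pow _ _ h1 _ hA; have e2 := pow _ _ h2 _ hA.
have ne (f : fT) v : f v -> U_ R f != 1.
  move=> fv; apply/eqP; rewrite -U_false => /U_inj /(_ v).
  by rewrite fv.
have n1 : U_ R f1 != 1 by apply: (ne _ [ffun => true]); rewrite ffunE.
have n2 : U_ R f2 != 1 by apply: (ne _ [ffun => false]); rewrite ffunE.
have : U_ R f1 = U_ R f2.
  have := U_involution R f1; have := U_involution R f2.
  rewrite e1 e2 in n1 n2 *; move=> i2 i1.
  exact: (power_involution t10 t20 n1 n2 i1 i2).
move/U_inj => /(_ [ffun => true]); rewrite !ffunE => /esym /eqP /ffunP /(_ (Ordinal n0)).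
by rewrite !ffunE.
Qed.

End LowerBound.
End LowerBound.

Import EndSpaces Circuits LowerBound.

Theorem mainTheorem11 (R : realType) :
  exists C : R, 0 < C /\
  forall (n : nat), (0 < n)%N ->
  forall (Delta : set (End_ R n)), algebraic Delta ->
  forall (p D : nat), has_dim Delta p -> has_degree Delta D ->
  exists f : {ffun 'I_n -> bool} -> bool,
    ((if (p%:R * n%:R + ln D%:R == 0 :> R)%R then +oo%E
     else ((C * 2 ^+ n / (p%:R * n%:R + ln D%:R))%R)%:E)
    <= stringent_complexity Delta (@U_ R n f))%E.
Proof.
(* In the count, [T + 1 <= 2 T] and [ln H <= 2 E] cost a factor 4, so [16^-1] leaves [2 ^ n / 4]
   against [2 ^ n * ln 2 >= 2 ^ n / 2]. *)
exists 16^-1; split; first by rewrite invr_gt0 ltr0n.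
move=> n n0 Delta _ p D hp hD.
set E := p%:R * n%:R + ln D%:R.
have lD : 0 <= ln (D%:R : R).
  case: D {E hD} => [|D]; first by rewrite ln0.
  by apply: ln_ge0; rewrite ler1n.
have pn0 : 0 <= p%:R * n%:R :> R by rewrite mulr_ge0 ?ler0n.
have E0 : 0 <= E by rewrite addr_ge0.
pose fT : finType := {ffun {ffun 'I_n -> bool} -> bool}.
apply: NNPP => none.
have low (f : fT) (b : \bar R) :
    ~ (b <= stringent_complexity Delta (U_ R f))%E ->
    exists t, factors_in Delta (U_ R f) t /\ ((t%:R : R)%:E < b)%E.
  move/negP; rewrite -ltNge => /ereal_inf_lt [_ [t ht <-] tb].
  by exists t.
have hall := fun f : fT => low f _ (fun h => none (ex_intro _ (f : _ -> _) h)).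
have [h [hh sp]] := degree_spans (2 ^ n) hp hD.
(* Both summands of [E] are nonnegative and [n > 0], so [E = 0] forces [p = 0] and [D <= 1]; [D = 0]
   is covered as [ln 0 = 0]. *)
case: eqP hall => [Ez|/eqP En] hall.
  have [pz lz] : p = 0%N /\ ln (D%:R : R) = 0.
    move/eqP: Ez; rewrite /E paddr_eq0 // => /andP[h1 /eqP ->]; split=> //.
    by apply/eqP; move: h1; rewrite mulf_eq0 !pnatr_eq0 (gtn_eqF n0) orbF.
  have D1 : (D <= 1)%N.
    rewrite leqNgt; apply/negP => D2.
    have : 0 < ln (D%:R : R) by apply: ln_gt0; rewrite ltr1n.
    by rewrite lz ltxx.
  have h1 : (h <= 1)%N.
    by apply: leq_trans hh _; rewrite pz expn0 muln1.
  have n2 : (0 < 2 ^ n)%N by rewrite expn_gt0.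
  rewrite -(prednK n2) in sp.
  have H1 A B : Delta A -> Delta B -> A = B.
    by move=> hA hB; apply: (SpanningFamilies.spans_le1 (@coordsK R n) sp h1).
  by apply: (single_point n0 H1) => f; have [t [ht _]] := hall f; exists t.
have {}E0 : 0 < E by rewrite lt_neqAle eq_sym En.
set x := 16^-1 * 2 ^+ n / E in hall.
have /all_sig [t ht] : forall f : fT, {t | factors_in Delta (U_ R f) t /\ t%:R < x}.
  by move=> f; apply: cid; have [t [h1 h2]] := hall f; exists t; rewrite -lte_fin.
pose T := (\max_f t f)%N.
pose f0 : fT := [ffun=> false].
have T1 : (0 < T)%N.
  by apply: leq_trans (ht f0).1.1 _; apply: (leq_bigmax (F := t)).
have Tx : T%:R < x.
  rewrite /T; elim/big_ind: _ => [|a b ha hb|f _]; last by case: (ht f).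
    by apply: le_lt_trans (ht f0).2; rewrite ler0n.
  by rewrite /maxn; case: ifP.
have cnt : (2 ^ 2 ^ n <= \sum_(t < T) h ^ t.+1)%N.
  apply: (count_all sp) => f; exists (t f).-1; have [[t0 _] _] := ht f.
  rewrite (prednK t0); split; first exact: (leq_bigmax (F := t)).
  by apply: factors_products; rewrite (prednK t0); case: (ht f).
set H := (maxn D 1 * (2 ^ n).+1 ^ p)%N.
have hH : (h <= H)%N by apply: leq_trans hh _; rewrite leq_mul2r leq_maxl orbT.
(* The comparison with the geometric sum requires this; [H = 1] would mean [p = 0] and [D <= 1],
   hence [E = 0]. *)
have H2 : (1 < H)%N.
  rewrite /H; case: (posnP p) => [p0|p0].
    rewrite p0 expn0 muln1 ltnNge; apply: contra En => D1; rewrite /E p0 mul0r add0r.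
    have : (D <= 1)%N by apply: leq_trans D1; rewrite leq_maxl.
    by case: (D) => [|[|//]] _; rewrite ?ln1 ?ln0.
  apply: (@leq_trans ((2 ^ n).+1 ^ p)); last by rewrite leq_pmull //; lia.
  apply: (@leq_trans ((2 ^ n).+1 ^ 1)); last by rewrite leq_pexp2l.
  by rewrite expn1 ltnS expn_gt0.
have {}cnt : (2 ^ 2 ^ n <= H ^ T.+1)%N.
  apply: leq_trans cnt _; apply: leq_trans (ltnW (sum_expn_lt T H2)).
  by apply: leq_sum => i _; rewrite leq_exp2r.
have lnH := ln_base_le R p D n0; rewrite -/H -/E in lnH.
have {}cnt : 2 ^+ n * ln 2 <= T.+1%:R * ln (H%:R : R).
  have H0 : 0 < (H%:R : R) by rewrite ltr0n; apply: ltnW.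
  rewrite -natrX !mulr_natl -!lnXn // -!natrX ler_ln ?posrE ?ltr0n ?expn_gt0 ?(ltnW H2) //.
  by rewrite ler_nat.
have l2 := ln2_ge R; have e2 : 0 < 2 ^+ n :> R by rewrite exprn_gt0.
have xE : x * E = 16^-1 * 2 ^+ n by rewrite /x divfK // gt_eqF.
(* Holds as [T >= 1]: every factorization has at least one factor. *)
have T2 : T.+1%:R <= 2 * T%:R :> R by rewrite -natrM ler_nat mul2n -addnn -addn1 leq_add2l.
have s1 : T.+1%:R * ln (H%:R : R) <= T.+1%:R * (2 * E) by apply: ler_wpM2l.
have s2 : T.+1%:R * (2 * E) <= 2 * x * (2 * E).
  apply: ler_wpM2r; first by rewrite mulr_ge0 // ltW.
  by apply: le_trans T2 _; rewrite ler_pM2l // ltW.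
have s3 : 2 * x * (2 * E) = 4^-1 * 2 ^+ n.
  by rewrite mulrACA xE; field.
have s4 : 2 ^+ n * 2^-1 <= 2 ^+ n * ln 2 :> R by rewrite ler_pM2l.
lra.
Qed.
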